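(* Let $\tau$ be a stopping time of $\{\mathcal{G}_t\}$ with $\mathbb{E}[\tau^2]<\infty$. Then for every $i=1,\dots,n$, the expected cumulative waiting time for type-$i$ items within one clearing cycle $\tau$ is $$\mathbb{E}\left[\int_0^\tau N_i(u)\,du\right]=\frac{1}{2D_i}\mathbb{E}[N_i^2(\tau)]-\frac{\sigma_i^2}{2D_i^2}\mathbb{E}[N_i(\tau)]=\frac12D_i\mathbb{E}[\tau^2]+\sigma_i\mathbb{E}[\tau B_i(\tau)].$$
   Context: Let $n\ge 1$, let $B_1,\dots,B_n$ be independent standard Brownian motions (started at $0$), and let $N_i(t)=D_it+\sigma_iB_i(t)$ with $D_i>0$, $\sigma_i>0$ for $i=1,\dots,n$. Let $\{\mathcal{G}_t\}$ be the natural filtration, $\mathcal{G}_t$ being generated by $\{N_1(s),\dots,N_n(s):s\in[0,t]\}$. *)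

(* Defs.v *)
From mathcomp Require Import all_boot all_order all_algebra.
From mathcomp Require Import all_classical all_reals all_analysis.

Set Implicit Arguments.
Unset Strict Implicit.
Unset Printing Implicit Defensive.

Import Order.TTheory GRing.Theory Num.Theory.
Import numFieldNormedType.Exports.

Local Open Scope classical_set_scope.
Local Open Scope ring_scope.

Definition sigma_generated d (T : measurableType d) (R : realType) (I : Type)
    (D : set I) (X : I -> T -> R) : set_system T :=
  <<s \bigcup_(i in D) preimage_set_system setT (X i) measurable >>.

Definition mutually_independent d (T : measurableType d) (R : realType)
    (P : probability T R) (I : finType) (F : I -> set_system T) : Prop :=
  forall (J : {set I}) (E : I -> set T), (forall i, i \in J -> F i (E i)) ->
    P (\bigcap_(i in [set j | j \in J]) E i) = (\prod_(i in J) P (E i))%E.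

(* Processes are indexed by all of R, but only times t >= 0 are constrained. *)

Record standard_brownian_motion d (T : measurableType d) (R : realType)
    (P : probability T R) (W : R -> {RV P >-> R}) : Prop := {
  bm_start : {ae P, forall w, W 0 w = 0} ;
  bm_indep_increments : forall (m : nat) (t : nat -> R),
    0 <= t 0%N -> {homo t : i j / (i <= j)%N >-> i <= j} ->
    mutually_independent P (fun k : 'I_m =>
      preimage_set_system setT (fun w => W (t k.+1) w - W (t k) w) measurable) ;
  (* normal_prob takes the standard deviation, here sqrt (t - s) *)
  bm_gaussian_increments : forall (s t : R) (A : set R),
    0 <= s -> s < t -> measurable A ->
    P ((fun w => W t w - W s w) @^-1` A)
      = normal_prob 0 (Num.sqrt (t - s)) A ;
  bm_continuous_paths :
    {ae P, forall w, {within `[0, +oo[, continuous (fun t : R => W t w)}} }.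

Definition independent_processes d (T : measurableType d) (R : realType)
    (P : probability T R) (n : nat) (B : 'I_n -> R -> {RV P >-> R}) : Prop :=
  mutually_independent P
    (fun i => sigma_generated [set t : R | 0 <= t] (fun t w => B i t w)).

Definition drifted_process d (T : measurableType d) (R : realType)
    (P : probability T R) (n : nat) (D sigma : 'I_n -> R)
    (B : 'I_n -> R -> {RV P >-> R}) (i : 'I_n) (t : R) (w : T) : R :=
  D i * t + sigma i * B i t w.

Definition natural_filtration d (T : measurableType d) (R : realType) (n : nat)
    (N : 'I_n -> R -> T -> R) (t : R) : set_system T :=
  sigma_generated [set p : 'I_n * R | 0 <= p.2 <= t] (fun p => N p.1 p.2).

Definition stopping_time d (T : measurableType d) (R : realType)
    (G : R -> set_system T) (tau : T -> \bar R) : Prop :=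
  (forall w, (0 <= tau w)%E) /\
  (forall t : R, 0 <= t -> G t [set w | (tau w <= t%:E)%E]).

(* fine maps +oo to 0, so both definitions below carry a junk value where
   tau w = +oo, which is a null set as soon as tau has a finite moment. *)

Definition stopped d (T : measurableType d) (R : realType)
    (X : R -> T -> R) (tau : T -> \bar R) (w : T) : R :=
  X (fine (tau w)) w.

Definition integral_up_to d (T : measurableType d) (R : realType)
    (X : R -> T -> R) (tau : T -> \bar R) (w : T) : R :=
  \int[lebesgue_measure]_(u in `[0, fine (tau w)]) X u w.

(* Main.v *)
(* Only the i-th Brownian motion matters; write X for a version of it with
   X_0 = 0 and all paths continuous, T for a finite version of tau.  Independence
   of the increments of X from the joint natural filtration makes X a martingale
   with E[(X_t - X_s)^2 ; E] = (t - s) P(E) for every event E known at time s.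
   Approximating T from above on grids of mesh 1/m truncated at m, this isometry
   and Fatou's lemma show that the approximations of X_T converge in L^2 at rate
   (1 + E[T^2]) / m, whence
     E[X_T] = 0,  E[X_T^2] = E[T],  E[X_u ; E, u < T] = E[X_T ; E, u < T].
   The last identity, with Fubini's theorem, gives
     E[int_0^T X_u du] = int_0^oo E[X_u ; u < T] du
                       = int_0^oo E[X_T ; u < T] du = E[T X_T];
   applied to {X_u >= 0} and its complement it also yields
   E[|X_u| ; u < T] <= E[|X_T| ; u < T], so that E[T |X_T|] < oo is the only
   integrability needed.  The three formulas follow by expanding N = D t + sigma X. *)

Require Import Defs.
From HB Require Import structures.
From mathcomp Require Import all_boot all_order all_algebra.
From mathcomp Require Import all_classical all_reals all_analysis.
From mathcomp Require Import measurable_realfun ring lra.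

Set Implicit Arguments.
Unset Strict Implicit.
Unset Printing Implicit Defensive.

Import Order.TTheory GRing.Theory Num.Theory.
Import numFieldNormedType.Exports.

Local Open Scope classical_set_scope.
Local Open Scope ring_scope.

(** * Square-integrable random variables *)

(** No conditional expectation is used: every martingale statement is tested on events known at a
    given time, and [adapted_motion] collects what is needed of a Brownian motion relative to a
    filtration. Two obstacles shape the proof. First, paths start at 0 and are continuous only
    almost surely, and [tau] may be infinite on a null set that need not be known at time t.
    Repairing paths and [tau] therefore forces an enlargement of the filtration, while the
    expectations to compute still concern the raw variables, whose measurability is not at hand;
    [integral_eq_full] bridges this gap. Second, [tau] is unbounded. Instead of uniform
    integrability, the squared error of the grid approximation is decomposed exactly. If [tau] falls
    inside a step, what is missing is an increment over at most one mesh, and these cases are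
    disjoint, so together they cost at most 1/m. If [tau] falls beyond the end m of the grid, the
    cost is the mean excess over m, at most E[T^2]/m. The first formula holds because E[X_T^2] =
    E[T] produces in E[N^2] exactly the multiple of E[T] that the E[N] term removes. *)

Section square_integrable.
Context d (T : measurableType d) (R : realType) (P : probability T R).
Implicit Types (f g : T -> R) (A : set T).

Lemma integrable_le f g : measurable_fun setT f ->
  P.-integrable setT (EFin \o g) -> (forall w, `|f w| <= g w) ->
  P.-integrable setT (EFin \o f).
Proof.
move=> mf ig fg; apply: (le_integrable measurableT _ _ ig).
  exact/measurable_EFinP.
by move=> w _ /=; rewrite lee_fin (le_trans (fg w))// ler_norm.
Qed.

Lemma integrable_EFinD f g :
  P.-integrable setT (EFin \o f) -> P.-integrable setT (EFin \o g) ->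
  P.-integrable setT (EFin \o (fun w => f w + g w)).
Proof. by move=> hf hg; exact: (integrableD measurableT hf hg). Qed.

Lemma integrable_EFinB f g :
  P.-integrable setT (EFin \o f) -> P.-integrable setT (EFin \o g) ->
  P.-integrable setT (EFin \o (fun w => f w - g w)).
Proof. by move=> hf hg; exact: (integrableB measurableT hf hg). Qed.

Lemma integrable_EFinZ (k : R) f :
  P.-integrable setT (EFin \o f) ->
  P.-integrable setT (EFin \o (fun w => k * f w)).
Proof. by move=> hf; exact: (integrableZl measurableT k hf). Qed.

Lemma integrable_EFin_cst (k : R) : P.-integrable setT (EFin \o (fun=> k)).
Proof. exact: (finite_measure_integrable_cst P k measurableT). Qed.

Definition square_integrable f :=
  measurable_fun setT f /\ P.-integrable setT (EFin \o (fun w => f w ^+ 2)).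

Lemma square_integrable_le f g : measurable_fun setT f ->
  square_integrable g -> (forall w, `|f w| <= `|g w|) -> square_integrable f.
Proof.
move=> mf [mg ig] fg; split => //; apply: (integrable_le _ ig).
  exact: measurable_funX.
by move=> w; rewrite normrX -[leRHS]real_normK ?num_real// lerXn2r// nnegrE.
Qed.

Lemma square_integrable_mul f g : square_integrable f -> square_integrable g ->
  P.-integrable setT (EFin \o (fun w => f w * g w)).
Proof.
move=> [mf f2] [mg g2].
apply: (@integrable_le _ (fun w => f w ^+ 2 + g w ^+ 2)).
- exact: measurable_funM.
- exact: integrable_EFinD.
- move=> w; rewrite normrM -[f w ^+ 2]real_normK ?num_real//.
  by rewrite -[g w ^+ 2]real_normK ?num_real//; nra.
Qed.

Lemma square_integrableD f g : square_integrable f -> square_integrable g ->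
  square_integrable (fun w => f w + g w).
Proof.
move=> [mf f2] [mg g2]; split; first exact: measurable_funD.
have i : P.-integrable setT (EFin \o (fun w => 2 * (f w ^+ 2 + g w ^+ 2))).
  by apply: integrable_EFinZ; exact: integrable_EFinD.
apply: (integrable_le _ i).
  by apply: measurable_funX => //; exact: measurable_funD.
by move=> w; rewrite ger0_norm ?sqr_ge0//; have := sqr_ge0 (f w - g w); nra.
Qed.

Lemma square_integrableZ (k : R) f : square_integrable f ->
  square_integrable (fun w => k * f w).
Proof.
move=> [mf f2]; split; first exact: measurable_funM.
rewrite (_ : (fun w => _) = fun w => k ^+ 2 * f w ^+ 2); last first.
  by apply/funext => w; rewrite exprMn.
exact: integrable_EFinZ.
Qed.

Lemma square_integrableB f g : square_integrable f -> square_integrable g ->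
  square_integrable (fun w => f w - g w).
Proof.
move=> hf /(square_integrableZ (-1)) hg.
have := square_integrableD hf hg.
by congr square_integrable; apply/funext => w; rewrite mulN1r.
Qed.

Lemma square_integrable_cst (k : R) : square_integrable (cst k).
Proof.
split; first exact: measurable_cst.
exact: (integrable_EFin_cst (k ^+ 2)).
Qed.

Lemma square_integrable_indicM A f : measurable A -> square_integrable f ->
  square_integrable (fun w => \1_A w * f w).
Proof.
move=> mA hf; apply: (square_integrable_le _ hf).
  by apply: measurable_funM; [exact: measurable_indic|case: hf].
by move=> w; rewrite indicE; case: (_ \in _); rewrite ?mul1r// mul0r normr0.
Qed.

Lemma square_integrable_indic A : measurable A -> square_integrable \1_A.
Proof.
move=> mA; have := square_integrable_indicM mA (square_integrable_cst 1).
by congr square_integrable; apply/funext => w; rewrite mulr1.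
Qed.

Lemma square_integrable_sum (I : Type) (s : seq I) (f : I -> T -> R) :
  (forall i, square_integrable (f i)) ->
  square_integrable (fun w => \sum_(i <- s) f i w).
Proof.
move=> hf; elim: s => [|i s ih].
  have := square_integrable_cst 0.
  by congr square_integrable; apply/funext => w; rewrite big_nil.
have := square_integrableD (hf i) ih.
by congr square_integrable; apply/funext => w; rewrite big_cons.
Qed.

Lemma square_integrable_integrable f : square_integrable f ->
  P.-integrable setT (EFin \o f).
Proof.
move=> hf; have := square_integrable_mul hf (square_integrable_cst 1).
by congr (_.-integrable _ _); apply/funext => w /=; rewrite mulr1.
Qed.

Lemma integrable_indicM A f : measurable A -> P.-integrable setT (EFin \o f) ->
  P.-integrable setT (EFin \o (fun w => \1_A w * f w)).
Proof.
move=> mA hf; have mf : measurable_fun setT f.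
  by apply/measurable_EFinP; exact: measurable_int hf.
apply: (@integrable_le _ (fun w => `|f w|)).
- by apply: measurable_funM => //; exact: measurable_indic.
- exact: integrable_abse hf.
- by move=> w; rewrite indicE; case: (_ \in _); rewrite ?mul1r// mul0r normr0.
Qed.

Lemma Rintegral_indic A : measurable A -> \int[P]_w \1_A w = fine (P A).
Proof. by move=> mA; rewrite /Rintegral integral_indic// setIT. Qed.

Lemma Rintegral_cstP (k : R) : \int[P]_w k = k.
Proof. by rewrite /Rintegral integral_cst//= probability_setT mule1. Qed.

Lemma Rintegral_sum (I : Type) (s : seq I) (f : I -> T -> R) :
  (forall i, P.-integrable setT (EFin \o f i)) ->
  \int[P]_w (\sum_(i <- s) f i w) = \sum_(i <- s) \int[P]_w f i w.
Proof.
(* Splitting the integral of a longer sum needs integrability of the shorter one, so both facts go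
   through one induction. *)
move=> hf; have h : P.-integrable setT (EFin \o (fun w => \sum_(i <- s) f i w)) /\
    \int[P]_w (\sum_(i <- s) f i w) = \sum_(i <- s) \int[P]_w f i w.
  elim: s => [|i s [ih1 ih2]].
    split.
      have := integrable_EFin_cst 0.
      by congr (_.-integrable _ _); apply/funext => w /=; rewrite big_nil.
    under eq_Rintegral do rewrite big_nil.
    by rewrite big_nil Rintegral_cst// mul0r.
  split.
    have := integrable_EFinD (hf i) ih1.
    by congr (_.-integrable _ _); apply/funext => w /=; rewrite big_cons.
  under eq_Rintegral do rewrite big_cons.
  by rewrite RintegralD// ih2 big_cons.
by case: h.
Qed.

Lemma EFin_Rintegral f : P.-integrable setT (EFin \o f) ->
  (\int[P]_w f w)%:E = (\int[P]_w (f w)%:E)%E.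
Proof. by move=> hf; rewrite /Rintegral fineK// integrable_fin_num. Qed.

End square_integrable.

(** The joint law of the pair agrees with the product of the two laws on rectangles, hence
    everywhere; Fubini then factors the integral of the coordinate product. *)
Lemma Rintegral_indep_mul d (T : measurableType d) (R : realType)
    (P : probability T R) (Z Y : T -> R) :
  P.-integrable setT (EFin \o Z) -> P.-integrable setT (EFin \o Y) ->
  P.-integrable setT (EFin \o (fun w => Z w * Y w)) ->
  (forall A C, measurable A -> measurable C ->
     P (Z @^-1` A `&` Y @^-1` C) = (P (Z @^-1` A) * P (Y @^-1` C))%E) ->
  \int[P]_w (Z w * Y w) = (\int[P]_w Z w) * (\int[P]_w Y w).
Proof.
move=> iZ iY iZY ind.
have mZ : measurable_fun setT Z.
  by apply/measurable_EFinP; exact: measurable_int iZ.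
have mY : measurable_fun setT Y.
  by apply/measurable_EFinP; exact: measurable_int iY.
pose Z' : {RV P >-> R} := HB.pack Z (isMeasurableFun.Build _ _ _ _ _ mZ).
pose Y' : {RV P >-> R} := HB.pack Y (isMeasurableFun.Build _ _ _ _ _ mY).
have mphi := measurable_fun_pair mZ mY.
pose phi : {RV P >-> (R * R)%type} :=
  HB.pack (fun w => (Z w, Y w)) (isMeasurableFun.Build _ _ _ _ _ mphi).
have E : forall X, measurable X ->
    (distribution P Z' \x distribution P Y')%E X = distribution P phi X.
  apply: product_measure_unique => A C mA mC.
  by rewrite /distribution /pushforward /= -ind.
pose h (z : R * R) := (z.1 * z.2)%:E.
have mh : measurable_fun setT h.
  apply/measurable_EFinP; apply: measurable_funM.
    exact: measurable_fst.
  exact: measurable_snd.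
have hphi : P.-integrable setT (h \o phi) by exact: iZY.
have ih : (distribution P Z' \x distribution P Y')%E.-integrable setT h.
  apply/integrableP; split => //.
  rewrite (eq_measure_integral (distribution P phi)); last by move=> *; exact: E.
  have /integrableP[_] :=
    @integrable_pushforward _ _ _ _ R _ mphi P setT h mh hphi measurableT.
  exact.
have : (\int[distribution P Z' \x distribution P Y']_z h z =
        (\int[P]_w Z w)%:E * (\int[P]_w Y w)%:E)%E.
  rewrite -integral12_prod_meas1//=.
  have iY' : (distribution P Y').-integrable setT (EFin : R -> _).
    exact: (@integrable_pushforward _ _ _ _ R _ mY P setT (EFin : R -> _)).
  have iZ' : (distribution P Z').-integrable setT (EFin : R -> _).
    exact: (@integrable_pushforward _ _ _ _ R _ mZ P setT (EFin : R -> _)).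
  have EY : (\int[distribution P Y']_y y%:E = (\int[P]_w Y w)%:E)%E.
    by rewrite EFin_Rintegral// integral_distribution.
  have EZ : (\int[distribution P Z']_y y%:E = (\int[P]_w Z w)%:E)%E.
    by rewrite EFin_Rintegral// integral_distribution.
  under eq_integral => x _.
    rewrite /fubini_F /h /=.
    under eq_integral do rewrite EFinM.
    rewrite integralZl// EY.
    over.
  by rewrite integralZr// EZ.
rewrite (eq_measure_integral (distribution P phi)); last by move=> *; exact: E.
rewrite integral_distribution//.
rewrite -EFin_Rintegral// -EFinM => -[].
by [].
Qed.

(** * Moments of the normal law *)

Section normal_moments.
Context (R : realType).
Local Notation mu := (@lebesgue_measure R).

(** The Radon-Nikodym derivative of [normal_prob] and the explicit density have the same integral
    over every measurable set, so they agree almost everywhere and can be exchanged in the change of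
    variables. *)
Lemma ge0_integral_normal_prob (m s : R) (f : R -> \bar R) :
  measurable_fun setT f -> (forall x, 0 <= f x)%E ->
  (\int[normal_prob m s]_x f x = \int[mu]_x (f x * (normal_pdf m s x)%:E))%E.
Proof.
move=> mf f0.
have dom := normal_prob_dominates m s.
have mpdf : measurable_fun setT (EFin \o normal_pdf m s).
  by apply/measurable_EFinP; exact: measurable_normal_pdf.
rewrite -(Radon_Nikodym_SigmaFinite.change_of_variables dom f0 measurableT mf).
have iRN := Radon_Nikodym_SigmaFinite.f_integrable dom.
apply: ae_eq_integral => //.
- by apply: emeasurable_funM => //; exact: measurable_int iRN.
- exact: emeasurable_funM.
- apply: ae_eqe_mul2l; apply: integral_ae_eq => //= E _ mE.
  by rewrite -Radon_Nikodym_SigmaFinite.f_integral.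
Qed.

Lemma derive_expRsqr (c x : R) :
  is_derive x 1 (fun x => - x * expR (- x ^+ 2 / c))
    ((2 * x ^+ 2 / c - 1) * expR (- x ^+ 2 / c)).
Proof.
apply: is_derive_eq.
by rewrite /GRing.scale /=; ring.
Qed.
Lemma normal_pdf0E (s : R) : s != 0 ->
  normal_pdf 0 s = fun x => normal_peak s * expR (- x ^+ 2 / (s ^+ 2 *+ 2)).
Proof.
by move=> s0; rewrite normal_pdfE//; apply/funext => x; rewrite /normal_fun subr0.
Qed.

(** [h] is the derivative of [F], which vanishes at 0 and at infinity. Hence x^2/s^2 and 1 have the
    same integral against the density over the half-line: an integration by parts in disguise. *)
Let F (s x : R) : R := - x * normal_pdf 0 s x.
Let h (s x : R) : R := (x ^+ 2 / s ^+ 2 - 1) * normal_pdf 0 s x.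

Let is_derive_F (s x : R) : s != 0 -> is_derive x 1 (F s) (h s x).
Proof.
move=> s0; have := @is_deriveZ _ _ _ _ (normal_peak s) x 1 _
  (derive_expRsqr (s ^+ 2 *+ 2) x).
rewrite (_ : _ \*: _ = F s); last first.
  by apply/funext => y /=; rewrite /F normal_pdf0E// /GRing.scale/=; ring.
move/is_derive_eq; apply; rewrite /h normal_pdf0E// /GRing.scale/=.
by rewrite -mulr_natr; field.
Qed.

Let cvg_F (s : R) : s != 0 -> F s x @[x --> +oo] --> 0.
Proof.
move=> s0; set c := s ^+ 2 *+ 2; have c0 : 0 < c.
  by rewrite /c pmulrn_lgt0// exprn_even_gt0.
have p0 : 0 <= normal_peak s by exact: normal_peak_ge0.
have lim : - (normal_peak s * c) * x^-1 @[x --> +oo] --> 0.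
  rewrite -[X in _ --> X](mulr0 (- (normal_peak s * c))).
  apply: cvgM; first exact: cvg_cst.
    by apply/gtr0_cvgV0; [exact: nbhs_pinfty_gt|exact: cvg_id].
apply: (squeeze_cvgr _ lim (@cvg_cst _ _ _ _ _)).
near=> x; have x0 : 0 < x by near: x; apply: nbhs_pinfty_gt; rewrite num_real.
rewrite /F normal_pdf0E// -/c.
apply/andP; split; last first.
  by rewrite mulNr oppr_le0 mulr_ge0// ?mulr_ge0// ?expR_ge0 ?ltW.
(* From 1 + y <= exp y with y = x^2/c. It bounds [F] from below by a multiple of -1/x. *)
have xc : x ^+ 2 / c * expR (- x ^+ 2 / c) <= 1.
  rewrite mulNr expRN ler_pdivrMr ?expR_gt0// mul1r.
  by apply: le_trans (expR_ge1Dx _); rewrite lerDr.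
have -> : - x * (normal_peak s * expR (- x ^+ 2 / c)) =
    - (normal_peak s * c) / x * (x ^+ 2 / c * expR (- x ^+ 2 / c)).
  by clearbody c; field; rewrite (gt_eqF x0) (gt_eqF c0).
by rewrite ler_niMr// mulNr oppr_le0 divr_ge0 ?mulr_ge0// ltW.
Unshelve. all: by end_near. Qed.

Let continuous_h (s : R) : s != 0 -> continuous (h s).
Proof.
move=> s0 x; apply: cvgM; last exact: continuous_normal_pdf.
apply: cvgB; last exact: cvg_cst.
by apply: cvgM; [exact: exprn_continuous|exact: cvg_cst].
Qed.

Let continuous_F (s : R) : s != 0 -> continuous (F s).
Proof.
move=> s0 x; apply: cvgM; last exact: continuous_normal_pdf.
exact: opp_continuous.
Qed.

Let continuous_q (s : R) : s != 0 ->
  continuous (fun x : R => x ^+ 2 / s ^+ 2 * normal_pdf 0 s x).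
Proof.
move=> s0 x; apply: cvgM; last exact: continuous_normal_pdf.
by apply: cvgM; [exact: exprn_continuous|exact: cvg_cst].
Qed.

Let F'E (s : R) : s != 0 -> forall x, derive1 (F s) x = h s x.
Proof. by move=> s0 x; rewrite derive1E; have [_ ->] := is_derive_F x s0. Qed.

(** The half-line is cut at [s], where [h] changes sign: beyond [s] the fundamental theorem on an
    unbounded interval applies to the nonnegative [h], and on [0, s] the compact version does. The
    two boundary terms at [s] cancel. *)
Let half (s : R) : 0 < s ->
  (\int[mu]_(x in `[0%R, +oo[) (x ^+ 2 / s ^+ 2 * normal_pdf 0 s x)%:E =
   \int[mu]_(x in `[0%R, +oo[) (normal_pdf 0 s x)%:E)%E.
Proof.
move=> s_gt0; have s0 : s != 0 by rewrite gt_eqF.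
have p0 x : 0 <= normal_pdf 0 s x by exact: normal_pdf_ge0.
have q0 x : 0 <= x ^+ 2 / s ^+ 2 * normal_pdf 0 s x.
  by rewrite mulr_ge0// divr_ge0// sqr_ge0.
have dF x : derivable (F s) x 1 by have [] := is_derive_F x s0.
have I1 : (\int[mu]_(x in `[s, +oo[) (h s x)%:E = 0%:E - (F s s)%:E)%E.
  apply: ge0_continuous_FTC2y.
  - move=> x sx; rewrite mulr_ge0// subr_ge0 ler_pdivlMr ?exprn_gt0// mul1r.
    by rewrite lerXn2r// nnegrE ltW// (lt_le_trans s_gt0).
  - exact/continuous_subspaceT/continuous_h.
  - exact: cvg_F.
  - by [].
  - exact/cvg_at_right_filter/continuous_F.
  - by move=> x _; exact: F'E.
have I0 : (\int[mu]_(x in `[0%R, s]) (h s x)%:E = (F s s)%:E - (F s 0)%:E)%E.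
  apply: continuous_FTC2 => //.
  - exact/continuous_subspaceT/continuous_h.
  - split => //.
      exact/cvg_at_right_filter/continuous_F.
    exact/cvg_at_left_filter/continuous_F.
  - by move=> x _; exact: F'E.
have mq (A : set R) :
    measurable_fun A (fun x : R => (x ^+ 2 / s ^+ 2 * normal_pdf 0 s x)%:E).
  apply/measurable_funTS/measurable_EFinP.
  exact: continuous_measurable_fun (continuous_q s0).
have mp (A : set R) : measurable_fun A (fun x : R => (normal_pdf 0 s x)%:E).
  by apply/measurable_funTS/measurable_EFinP; exact: measurable_normal_pdf.
have mh (A : set R) : measurable_fun A (fun x : R => (h s x)%:E).
  apply/measurable_funTS/measurable_EFinP.
  exact: continuous_measurable_fun (continuous_h s0).
have qE x : ((x ^+ 2 / s ^+ 2 * normal_pdf 0 s x)%:E =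
  (h s x)%:E + (normal_pdf 0 s x)%:E)%E.
  by rewrite -EFinD /h mulrBl mul1r subrK.
have Iq1 : (\int[mu]_(x in `[s, +oo[) (x ^+ 2 / s ^+ 2 * normal_pdf 0 s x)%:E =
   - (F s s)%:E + \int[mu]_(x in `[s, +oo[) (normal_pdf 0 s x)%:E)%E.
  under eq_integral do rewrite qE.
  rewrite ge0_integralD//=.
  - by rewrite I1 -EFinB sub0r.
  - move=> x; rewrite in_itv/= andbT => sx.
    rewrite lee_fin mulr_ge0// subr_ge0 ler_pdivlMr ?exprn_gt0// mul1r.
    by rewrite lerXn2r// nnegrE ltW// (lt_le_trans s_gt0).
  - exact: mh.
  - by move=> x _; rewrite lee_fin.
  - exact: mp.
have Iq0 : (\int[mu]_(x in `[0%R, s]) (x ^+ 2 / s ^+ 2 * normal_pdf 0 s x)%:E =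
   (F s s)%:E + \int[mu]_(x in `[0%R, s]) (normal_pdf 0 s x)%:E)%E.
  under eq_integral do rewrite qE.
  rewrite integralD_EFin ?I0 //=.
  - by rewrite {2}/F oppr0 mul0r sube0.
  - apply: continuous_compact_integrable => //; first exact: segment_compact.
    exact/continuous_subspaceT/continuous_h.
  - apply: continuous_compact_integrable => //; first exact: segment_compact.
    exact/continuous_subspaceT/continuous_normal_pdf.
have split_itv (f : R -> R) : (forall x, 0 <= f x) ->
    (forall A : set R, measurable_fun A (fun x : R => (f x)%:E)) ->
    (\int[mu]_(x in `[0%R, +oo[) (f x)%:E =
    \int[mu]_(x in `[0%R, s]) (f x)%:E + \int[mu]_(x in `[s, +oo[) (f x)%:E)%E.
  move=> f0 mf; rewrite -(integral_itv_bndo_bndc (mf _)).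
  rewrite -ge0_integral_setU//=; last 3 first.
  - exact: mf.
  - by move=> x _; rewrite lee_fin.
  - apply/disj_setPLR => x /=; rewrite !in_itv/= andbT => /andP[_ xs].
    by apply/negP; rewrite -ltNge.
  by rewrite -itv_bndbnd_setU// bnd_simp ltW.
rewrite !split_itv// Iq1 Iq0.
rewrite addeACA -EFinN -EFinD subrr add0e.
by [].
Qed.

Lemma normal_second_moment (s : R) : 0 < s ->
  (\int[normal_prob 0 s]_x (x ^+ 2)%:E = (s ^+ 2)%:E)%E.
Proof.
move=> s_gt0; have s0 : s != 0 by rewrite gt_eqF.
rewrite ge0_integral_normal_prob; last 2 first.
- apply/measurable_EFinP; apply: measurable_funX; exact: measurable_id.
- by move=> x; rewrite lee_fin sqr_ge0.
have p_even x : normal_pdf 0 s (- x) = normal_pdf 0 s x.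
  by rewrite normal_pdf0E// sqrrN.
have -> : (\int[mu]_x ((x ^+ 2)%:E * (normal_pdf 0 s x)%:E) =
   (s ^+ 2)%:E * \int[mu]_x (x ^+ 2 / s ^+ 2 * normal_pdf 0 s x)%:E)%E.
  rewrite -ge0_integralZl//=.
  - by apply: eq_integral => x _; rewrite -!EFinM; congr EFin; field.
  - by apply/measurable_EFinP; exact: continuous_measurable_fun (continuous_q s0).
  - move=> x _; rewrite lee_fin mulr_ge0 ?normal_pdf_ge0//.
    by rewrite divr_ge0// sqr_ge0.
  - by rewrite lee_fin sqr_ge0.
rewrite ge0_symfun_integralT; last 3 first.
- by move=> x; rewrite mulr_ge0 ?normal_pdf_ge0// divr_ge0// sqr_ge0.
- exact: continuous_q.
- by move=> x /=; rewrite p_even sqrrN.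
rewrite -set_itvcy half// set_itvcy -ge0_symfun_integralT; last 3 first.
- by move=> x; exact: normal_pdf_ge0.
- exact: continuous_normal_pdf.
- by move=> x /=; rewrite p_even.
by rewrite integral_normal_pdf mule1.
Qed.

Lemma normal_probN (s : R) (A : set R) : s != 0 -> measurable A ->
  normal_prob 0 s (-%R @^-1` A) = normal_prob 0 s A.
Proof.
move=> s0 mA; rewrite /normal_prob.
transitivity (\int[mu]_(x in (-%R : _ -> measurableTypeR R) @^-1` A)
    (normal_pdf 0 s (- x))%:E)%E.
  by apply: eq_integral => x _; rewrite normal_pdf0E// sqrrN.
rewrite -(ge0_integral_pushforward
  (phi := (-%R : measurableTypeR R -> measurableTypeR R)) _ _ _
  (f := EFin \o normal_pdf 0 s))//=.
- by apply: eq_measure_integral => /= B mB _; exact: lebesgue_measureN.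
- by apply/measurable_funTS/measurable_EFinP; exact: measurable_normal_pdf.
- by move=> x _; rewrite lee_fin normal_pdf_ge0.
Qed.

Lemma square_integrable_normal (s : R) : 0 < s ->
  square_integrable (normal_prob 0 s) id.
Proof.
move=> s0; split; first exact: measurable_id.
apply/integrableP; split.
  by apply/measurable_EFinP; apply: measurable_funX; exact: measurable_id.
under eq_integral do rewrite /= ger0_norm ?sqr_ge0//.
by rewrite normal_second_moment// ltry.
Qed.

(** The law is invariant under negation, so its mean equals its own opposite. *)
Lemma normal_mean (s : R) : 0 < s -> \int[normal_prob 0 s]_x x = 0.
Proof.
move=> s0.
have i := square_integrable_integrable (square_integrable_normal s0).
have mN : measurable_fun setT (-%R : measurableTypeR R -> measurableTypeR R).
  exact: oppr_measurable.
suff : \int[normal_prob 0 s]_x x = - \int[normal_prob 0 s]_x x by lra.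
rewrite [RHS](_ : _ = \int[normal_prob 0 s]_x (- x)); last first.
  rewrite -mulN1r -RintegralZl//.
  by apply: eq_Rintegral => x _; rewrite mulN1r.
rewrite /Rintegral; congr fine.
have iN : (normal_prob 0 s).-integrable setT (EFin \o -%R).
  have := integrable_EFinZ (-1) i.
  by congr (_.-integrable _ _); apply/funext => x /=; rewrite mulN1r.
have := @integral_pushforward _ _ _ _ R _ mN (normal_prob 0 s) setT
  (EFin : R -> \bar R) (@EFin_measurable _ _) iN measurableT.
rewrite preimage_setT => <-.
apply: eq_measure_integral => A mA _; apply/esym.
by apply: normal_probN => //; rewrite gt_eqF.
Qed.
End normal_moments.

(** * Independence of the increments from the past *)

Lemma eq_measure_full d (T : measurableType d) (R : realType)
    (mu : {measure set T -> \bar R}) (A U V : set T) :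
  measurable A -> mu (~` A) = 0%E -> measurable U -> measurable V ->
  (forall w, A w -> U w <-> V w) -> mu U = mu V.
Proof.
move=> mA mA0 mU mV UV.
have muI W : measurable W -> mu W = mu (W `&` A).
  move=> mW; rewrite [LHS](measureDI mu mW mA).
  rewrite (@subset_measure0 _ _ _ mu (W `\` A) (~` A)) ?add0e//.
  - exact: measurableD.
  - exact: measurableC.
rewrite muI// [RHS]muI//; congr (mu _).
by apply/seteqP; split => w [? Aw]; split => //; apply/UV.
Qed.

Section independence.
Context d (T : measurableType d) (R : realType) (P : probability T R).

(** Uniqueness of finite measures on a pi-system, applied to the restriction of [P] to [C] and to
    [P] scaled by the probability of [C]. *)
Lemma indep_generated (G : set_system T) (C : set T) :
  measurable C -> G `<=` measurable -> setI_closed G ->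
  (forall E, G E -> P (E `&` C) = (P E * P C)%E) ->
  forall E, <<s G >> E -> P (E `&` C) = (P E * P C)%E.
Proof.
move=> mC mG GI GC.
have GE : [set X | G X /\ X `<=` setT] = G.
  by apply/seteqP; split => [X []//|X GX]; split.
have PC0 : 0 <= fine (P C) by exact: fine_ge0.
have PCE : P C = (fine (P C))%:E by rewrite fineK// fin_num_measure.
have m2E E : mscale (NngNum PC0) P E = (P E * P C)%E.
  by rewrite /mscale /= -PCE muleC.
have := @g_sigma_algebra_measure_unique_trace _ R T G setT measurableT.
rewrite GE => /(_ mG GI (mrestr P mC) (mscale (NngNum PC0) P)) h E GE'.
rewrite -m2E; apply: h => //=.
- by rewrite m2E /mrestr setTI probability_setT mul1e.
- by move=> A GA; rewrite m2E -GC.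
- by rewrite /mrestr setTI PCE ltry.
Qed.

(** Intersections of one event from each [F i] form a pi-system, and [F i setT] makes it contain
    every [F i]; so independence of [C] need only be tested on them. *)
Lemma indep_join (I : finType) (F : I -> set_system T) (C : set T) :
  measurable C -> (forall i, F i `<=` measurable) ->
  (forall i, F i setT) -> (forall i, setI_closed (F i)) ->
  (forall E : I -> set T, (forall i, F i (E i)) ->
    P (\bigcap_i E i `&` C) = (P (\bigcap_i E i) * P C)%E) ->
  forall E, <<s \bigcup_i F i >> E -> P (E `&` C) = (P E * P C)%E.
Proof.
move=> mC mF FT FI FC E.
pose G : set_system T :=
  [set B | exists2 E : I -> set T, (forall i, F i (E i)) & B = \bigcap_i E i].
have FG : \bigcup_i F i `<=` G.
  move=> A [i _ FA]; exists (fun j => if j == i then A else setT).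
    by move=> j; case: eqP => [->|].
  apply/seteqP; split => [w Aw j _|w /(_ i Logic.I)]; last by rewrite eqxx.
  by case: eqP.
move/(sub_sigma_algebra2 FG); apply: indep_generated => //.
- move=> _ [A FA ->]; apply: fin_bigcap_measurable => // i _; exact/mF/FA.
- move=> _ _ [A FA ->] [B FB ->]; exists (fun i => A i `&` B i).
    by move=> i; exact: FI.
  by rewrite bigcapI.
- by move=> _ [A FA ->]; exact: FC.
Qed.

Lemma sigma_generated_sub (I : Type) (A B : set I) (X : I -> T -> R) :
  A `<=` B -> sigma_generated A X `<=` sigma_generated B X.
Proof. by move=> AB; apply: sub_sigma_algebra2; exact: bigcup_subset. Qed.

Lemma sigma_generated_measurable (I : Type) (A : set I) (X : I -> T -> R) :
  (forall i, measurable_fun setT (X i)) ->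
  sigma_generated A X `<=` measurable.
Proof.
move=> mX; apply: smallest_sub; first exact: sigma_algebra_measurable.
by move=> _ [i _ [B mB <-]]; exact: mX.
Qed.

Lemma sigma_generated_preimage (I : Type) (A : set I) (X : I -> T -> R) i B :
  A i -> measurable B -> sigma_generated A X (X i @^-1` B).
Proof.
move=> Ai mB; apply: sub_sigma_algebra; exists i => //.
by exists B => //; rewrite setTI.
Qed.

Lemma sigma_generatedP (I : Type) (A : set I) (X : I -> T -> R)
    (H : set_system T) :
  (forall i, A i -> forall B, measurable B -> <<s H >> (X i @^-1` B)) ->
  sigma_generated A X `<=` <<s H >>.
Proof.
move=> XH; apply: smallest_sub; first exact: smallest_sigma_algebra.
by move=> _ [i Ai [B mB <-]]; rewrite setTI; exact: XH.
Qed.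

Lemma sigma_generatedT (I : Type) (A : set I) (X : I -> T -> R) :
  sigma_generated A X setT.
Proof. by rewrite -setC0; apply: sigma_algebraC; exact: sigma_algebra0. Qed.

Lemma sigma_generatedI (I : Type) (A : set I) (X : I -> T -> R) :
  setI_closed (sigma_generated A X).
Proof.
move=> B C hB hC.
exact: (@measurableI _ (g_sigma_algebraType _) B C hB hC).
Qed.

End independence.

Section preimage_system.
Context (T : Type) (R : realType) (X : T -> R).

Lemma preimage_systemT : preimage_set_system setT X measurable setT.
Proof. by exists setT => //; rewrite setTI preimage_setT. Qed.

Lemma preimage_systemI : setI_closed (preimage_set_system setT X measurable).
Proof.
move=> _ _ [A mA <-] [B mB <-]; exists (A `&` B); first exact: measurableI.
by rewrite !setTI preimage_setI.
Qed.
End preimage_system.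

Section brownian_independence.
Context d (T : measurableType d) (R : realType) (P : probability T R).

Lemma preimage_system_measurable (X : T -> R) : measurable_fun setT X ->
  preimage_set_system setT X measurable `<=` measurable.
Proof. by move=> mX _ [A mA <-]; exact: mX. Qed.

Lemma measurable_increment (W : R -> {RV P >-> R}) (s t : R) :
  measurable_fun setT (fun w => W t w - W s w).
Proof. exact: measurable_funB. Qed.

Definition increment (W : R -> {RV P >-> R}) (s t : R) (w : T) : R :=
  W t w - W s w.

(* [W 0] is only almost surely 0, so it enters as one more coordinate [None],
   which is independent of everything. *)
Definition grid_system (W : R -> {RV P >-> R}) (t : nat -> R) m
    (o : option 'I_m) : set_system T :=
  match o with
  | None => preimage_set_system setT (W 0) measurable
  | Some k => preimage_set_system setT (increment W (t k) (t k.+1)) measurable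
  end.

(** [indep_join] reduces this to one event per coordinate. The increments are covered by the
    independence of [m.+1] consecutive increments; an event about [W 0] is almost surely everything
    or nothing, according to whether its Borel set contains 0. *)
Lemma grid_increments_indep (W : R -> {RV P >-> R}) (t : nat -> R) m
    (A : set R) : standard_brownian_motion W ->
  t 0%N = 0 -> {homo t : i j / (i <= j)%N >-> i <= j} -> measurable A ->
  forall E, <<s \bigcup_o grid_system W t (m := m) o >> E ->
    P (E `&` increment W (t m) (t m.+1) @^-1` A) =
    (P E * P (increment W (t m) (t m.+1) @^-1` A))%E.
Proof.
move=> hW t0 tm mA.
have mC B : measurable B -> measurable (increment W (t m) (t m.+1) @^-1` B).
  by move=> mB; rewrite -[X in measurable X]setTI; exact: measurable_increment.
apply: indep_join => //.
- exact: mC.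
- by case=> [k|]; apply: preimage_system_measurable => //; exact: measurable_increment.
- by case=> [k|]; exact: preimage_systemT.
- by case=> [k|]; exact: preimage_systemI.
move=> E hE.
have EE : \bigcap_o E o = E None `&` \bigcap_(k : 'I_m) E (Some k).
  apply/seteqP; split => [w h|w [h1 h2] [k|] _ //]; last exact: h2.
  by split; [exact: h|move=> k _; exact: h].
(* Stated for every [B], so that [B = setT] later gives the product formula for the grid increments
   alone. *)
have indB B : measurable B ->
    P (\bigcap_(k : 'I_m) E (Some k) `&` increment W (t m) (t m.+1) @^-1` B) =
    ((\prod_(k < m) P (E (Some k))) * P (increment W (t m) (t m.+1) @^-1` B))%E.
  move=> mB.
  pose G (j : 'I_m.+1) := if unlift ord_max j is Some k then E (Some k)
    else increment W (t m) (t m.+1) @^-1` B.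
  have := @bm_indep_increments _ _ _ _ _ hW m.+1 t.
  rewrite t0 lexx => /(_ isT tm [set: 'I_m.+1]%SET G) h.
  have {}h : P (\bigcap_(i in [set j | j \in [set: 'I_m.+1]%SET]) G i) =
      (\prod_(i in [set: 'I_m.+1]%SET) P (G i))%E.
    apply: h => j _; rewrite /G; case: unliftP => [k ->|->].
      have := hE (Some k); rewrite /grid_system.
      by congr preimage_set_system; apply/funext => w;
        rewrite /increment lift_max.
    by exists B => //; rewrite setTI.
  have Gl k : G (widen_ord (leqnSn m) k) = E (Some k).
    rewrite /G (_ : widen_ord _ k = lift ord_max k) ?liftK//.
    by apply: val_inj; rewrite /= /bump leqNgt ltn_ord.
  have Gm : G ord_max = increment W (t m) (t m.+1) @^-1` B.
    by rewrite /G unlift_none.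
  transitivity (\prod_(i in [set: 'I_m.+1]%SET) P (G i))%E.
    rewrite -h; congr (P _); apply/seteqP; split => [w [h1 h2] j _|w hw].
      by rewrite /G; case: unliftP => [k _|_]; [exact: h1|exact: h2].
    split; last by rewrite -Gm; apply: hw; rewrite /= inE.
    by move=> k _; rewrite -Gl; apply: hw; rewrite /= inE.
  rewrite (eq_bigl predT); last by move=> j; rewrite inE.
  rewrite big_ord_recr /= Gm; congr (_ * _)%E.
  by apply: eq_bigr => k _; rewrite Gl.
have mE k : measurable (E (Some k)).
  have := hE (Some k); apply: preimage_system_measurable.
  exact: measurable_increment.
have mcap : measurable (\bigcap_(k : 'I_m) E (Some k)).
  by apply: fin_bigcap_measurable.
have indT : P (\bigcap_(k : 'I_m) E (Some k)) = (\prod_(k < m) P (E (Some k)))%E.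
  have := indB setT measurableT.
  by rewrite preimage_setT setIT probability_setT mule1.
have [A0 mA0 EA0] := hE None.
have mE0 : measurable (E None).
  exact: (preimage_system_measurable _ (hE None)).
have W0 B : measurable B -> P (E None `&` B) = if `[< A0 0 >] then P B else 0%E.
  move=> mB; have [N [mN PN hN]] := bm_start hW.
  have N0 w : (~` N) w -> W 0 w = 0.
    by move=> nN; apply: contrapT => nW; apply: nN; exact: hN.
  have PN' : P (~` ~` N) = 0%E by rewrite setCK.
  have mI := measurableI _ _ mE0 mB.
  case: asboolP => A00.
    apply: (eq_measure_full (measurableC mN) PN') => // w /N0 Ww.
    by rewrite -EA0; split => [[]//|Bw]; split => //; split => //=; rewrite Ww.
  rewrite -(measure0 P); apply: (eq_measure_full (measurableC mN) PN') => // w /N0 Ww.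
  by split => // -[+ _]; rewrite -EA0 => -[_] /=; rewrite Ww.
rewrite EE -setIA !W0//; last by apply: measurableI => //; exact: mC.
by case: ifP; rewrite ?mul0e// indB// indT.
Qed.

(** Telescoping: [W (t k)] is [W 0] plus the first k increments, each measurable for the generated
    sigma-algebra. *)
Lemma grid_system_values (W : R -> {RV P >-> R}) (t : nat -> R) m k :
  t 0%N = 0 -> (k <= m)%N -> forall B, measurable B ->
  <<s \bigcup_o grid_system W t (m := m) o >> (W (t k) @^-1` B).
Proof.
move=> t0; set S := \bigcup_o _ => km.
pose ST := g_sigma_algebraType S.
have mS (X : T -> R) : preimage_set_system setT X measurable `<=` S ->
    measurable_fun [set: ST] (X : ST -> R).
  by move=> XS _ B mB; apply: sub_sigma_algebra; apply: XS; exists B.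
suff mW : measurable_fun [set: ST] (W (t k) : ST -> R).
  by move=> B mB; rewrite -[_ @^-1` _]setTI; exact: mW.
elim: k km => [_|k ih km].
  by rewrite t0; apply: mS => A hA; exists None.
have -> : (W (t k.+1) : ST -> R) =
    (fun w => W (t k) w + increment W (t k) (t k.+1) w).
  by apply/funext => w; rewrite /increment subrKC.
apply: measurable_funD; first exact: ih (ltnW km).
by apply: mS => A hA; exists (Some (Ordinal km)).
Qed.

(* A finite list of times in [0, s] is completed to a nondecreasing grid which
   starts at 0, reaches s, and then jumps to t. *)
Lemma finite_past_indep (W : R -> {RV P >-> R}) (s t : R) (l : seq R)
    (A : set R) (E : set T) : standard_brownian_motion W ->
  0 <= s -> s <= t -> measurable A -> all (fun u => 0 <= u <= s) l ->
  sigma_generated [set u | u \in l] (fun u w => W u w) E ->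
  P (E `&` increment W s t @^-1` A) = (P E * P (increment W s t @^-1` A))%E.
Proof.
move=> hW s0 st mA ls hE.
pose L := 0 :: rcons (sort <=%R l) s.
(* The default value of [nth] is [t], so the grid is constantly [t] past the end of [L]: index
   [(size l).+1] gives [s], and the next one gives [t]. *)
pose tau i := nth t L i.
have Ls : all (fun u => u <= s) L.
  rewrite /L /= s0 /= all_rcons lexx /= all_sort.
  by apply: sub_all ls => u /andP[].
have sL : sorted <=%R L.
  rewrite /L /= (path_sortedE le_trans) all_rcons s0 /= all_sort.
  apply/andP; split; first by apply: sub_all ls => u /andP[].
  rewrite (sorted_pairwise le_trans) -cats1 pairwise_cat /= !andbT.
  rewrite -(sorted_pairwise le_trans) (sort_sorted le_total) andbT.
  by rewrite allrel1r /= all_sort; apply: sub_all ls => u /andP[].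
have szL : size L = (size l).+2 by rewrite /= size_rcons size_sort.
have tau0 : tau 0%N = 0 by [].
have taut i : (size L <= i)%N -> tau i = t by exact: nth_default.
have taum : {homo tau : i j / (i <= j)%N >-> i <= j}.
  move=> i j ij; have [jL|jL] := ltnP j (size L).
    by rewrite /tau (sorted_leq_nth le_trans lexx _ sL)// inE (leq_ltn_trans ij).
  rewrite (taut j)//; have [iL|iL] := ltnP i (size L); last by rewrite taut.
  by apply: le_trans st; move/all_nthP : Ls => /(_ t i iL).
have taus : tau (size l).+1 = s.
  by rewrite /tau /= nth_rcons size_sort ltnn eqxx.
have taust : tau (size l).+2 = t by rewrite taut// szL.
have := @grid_increments_indep W tau (size l).+1 A hW tau0 taum mA E.
rewrite taus taust; apply.
move: E hE; apply: sigma_generatedP => u /= ul B mB.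
have uL : u \in L by rewrite inE mem_rcons inE mem_sort ul !orbT.
have -> : u = tau (index u L) by rewrite /tau nth_index.
by apply: grid_system_values => //; rewrite -ltnS -szL index_mem.
Qed.

(** Events depending on finitely many times form a pi-system, since two lists of times can be
    concatenated, and they generate the past of [W]. *)
Lemma past_indep (W : R -> {RV P >-> R}) (s t : R) (A : set R) (E : set T) :
  standard_brownian_motion W -> 0 <= s -> s <= t -> measurable A ->
  sigma_generated [set u | 0 <= u <= s] (fun u w => W u w) E ->
  P (E `&` increment W s t @^-1` A) = (P E * P (increment W s t @^-1` A))%E.
Proof.
move=> hW s0 st mA.
pose H : set_system T := [set F | exists2 l : seq R,
  all (fun u => 0 <= u <= s) l &
  sigma_generated [set u | u \in l] (fun u w => W u w) F].
have mC : measurable (increment W s t @^-1` A).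
  by rewrite -[X in measurable X]setTI; exact: measurable_increment.
have sub : sigma_generated [set u | 0 <= u <= s] (fun u w => W u w) `<=` <<s H >>.
  apply: sigma_generatedP => u us B mB; apply: sub_sigma_algebra.
  exists [:: u]; first by rewrite /= us.
  by apply: (sigma_generated_preimage (i := u)) => //=; rewrite inE.
move=> /sub; apply: indep_generated => //.
- by move=> F [l _]; exact: sigma_generated_measurable.
- move=> F G [l ls lF] [l' ls' lG]; exists (l ++ l').
    by rewrite all_cat ls.
  apply: sigma_generatedI.
    by move: lF; apply: sigma_generated_sub => u /=; rewrite mem_cat => ->.
  by move: lG; apply: sigma_generated_sub => u /=; rewrite mem_cat orbC => ->.
- by move=> F [l ls lF]; exact: finite_past_indep lF.
Qed.

(** The increment of [B i] after [s] belongs to the sigma-algebra of the whole process [B i], so it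
    can be absorbed into the i-th factor. Independence of the processes splits the product, and
    [past_indep] then separates past from increment in that factor alone. *)
Lemma filtration_indep n (B : 'I_n -> R -> {RV P >-> R}) (D sigma : 'I_n -> R)
    (i : 'I_n) (s t : R) (A : set R) (E : set T) :
  (forall i, standard_brownian_motion (B i)) -> independent_processes B ->
  0 <= s -> s <= t -> measurable A ->
  natural_filtration (drifted_process D sigma B) s E ->
  P (E `&` increment (B i) s t @^-1` A) =
  (P E * P (increment (B i) s t @^-1` A))%E.
Proof.
move=> hB hindep s0 st mA.
set C := increment (B i) s t @^-1` A.
pose F j := sigma_generated [set u : R | 0 <= u <= s] (fun u w => B j u w).
pose F' j := sigma_generated [set u : R | 0 <= u] (fun u w => B j u w).
have FF' j : F j `<=` F' j by apply: sigma_generated_sub => u /= /andP[].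
have mC : measurable C.
  by rewrite /C -[X in measurable X]setTI; exact: measurable_increment.
have F'C : F' i C.
  pose ST := g_sigma_algebraType (\bigcup_(u in [set u : R | 0 <= u])
    preimage_set_system setT (B i u) measurable).
  have mB u : 0 <= u -> measurable_fun [set: ST] (B i u : ST -> R).
    move=> u0 _ X mX; apply: sub_sigma_algebra; exists u => //.
    by exists X.
  have : measurable_fun [set: ST] (increment (B i) s t : ST -> R).
    by apply: measurable_funB; apply: mB => //; exact: le_trans st.
  by move=> /(_ measurableT A mA); rewrite setTI.
have sub : natural_filtration (drifted_process D sigma B) s `<=`
    <<s \bigcup_j F j >>.
  apply: sigma_generatedP => -[j u] /= us X mX.
  apply: sub_sigma_algebra; exists j => //.
  rewrite [X in F j X](_ : _ =
    B j u @^-1` ((fun x => D j * u + sigma j * x) @^-1` X)) //.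
  apply: (sigma_generated_preimage (i := u)) => //.
  rewrite -[X in measurable X]setTI.
  have mf : measurable_fun setT (fun x : R => D j * u + sigma j * x).
    by apply: measurable_funD => //; exact: measurable_funM.
  exact: mf.
move=> /sub; apply: indep_join => //.
- by move=> j; exact: sigma_generated_measurable.
- by move=> j; exact: sigma_generatedT.
- by move=> j; exact: sigma_generatedI.
move=> G hG.
have all_indep (G' : 'I_n -> set T) : (forall j, F' j (G' j)) ->
    P (\bigcap_j G' j) = (\prod_j P (G' j))%E.
  move=> hG'; have := hindep [set: 'I_n]%SET G' (fun j _ => hG' j).
  rewrite (eq_bigl predT); last by move=> j; rewrite inE.
  move=> <-; congr (P _); apply/seteqP; split => [w h j _|w h j _]; first exact: h.
  by apply: h; rewrite /= inE.
pose G' j := if j == i then G i `&` C else G j.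
have capE : \bigcap_j G j `&` C = \bigcap_j G' j.
  apply/seteqP; split => [w [h Cw] j _|w h].
    by rewrite /G'; case: eqP => [_|_]; [split => //; exact: h|exact: h].
  split; last by have := h i Logic.I; rewrite /G' eqxx => -[].
  by move=> j _; have := h j Logic.I; rewrite /G'; case: eqP => [-> []|].
have GF' j : F' j (G j) by exact: (FF' j _ (hG j)).
have G'F' j : F' j (G' j).
  rewrite /G'; case: eqP => [->|_]; last exact: GF'.
  by apply: sigma_generatedI => //; exact: GF'.
rewrite capE (all_indep _ G'F') (all_indep _ GF').
rewrite (bigD1 i)//= [in RHS](bigD1 i)//= /G' eqxx.
rewrite (eq_bigr (fun j => P (G j))); last by move=> j /negbTE ->.
rewrite (past_indep (hB i) s0 st mA (hG i)).
by rewrite muleAC.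
Qed.

End brownian_independence.

(** * The discrete isometry *)

Section adapted_motion.
Context d (T : measurableType d) (R : realType) (P : probability T R).
Variables (X : R -> T -> R) (F : R -> set_system T).

(** A Brownian motion relative to a filtration, regular on every path. At each time [F u] is an
    algebra of events. [am_increment] encodes independence of the past and the Gaussian law
    together; the law is the case [E = setT]. *)
Record adapted_motion : Prop := {
  am_measurable : forall u, measurable_fun setT (X u) ;
  am_start : forall w, X 0 w = 0 ;
  am_continuous : forall w, continuous (fun u => X u w) ;
  am_event : forall u, F u `<=` measurable ;
  am_setT : forall u, F u setT ;
  am_setI : forall u, setI_closed (F u) ;
  am_setD : forall u, setD_closed (F u) ;
  am_mono : forall u v, u <= v -> F u `<=` F v ;
  am_adapted : forall u A, 0 <= u -> measurable A -> F u (X u @^-1` A) ;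
  am_increment : forall s t E A, 0 <= s -> s < t -> F s E -> measurable A ->
    P (E `&` (fun w => X t w - X s w) @^-1` A) =
    (P E * normal_prob 0 (Num.sqrt (t - s)) A)%E }.

Hypothesis hX : adapted_motion.

Let law s t A : 0 <= s -> s < t -> measurable A ->
  P ((fun w => X t w - X s w) @^-1` A) = normal_prob 0 (Num.sqrt (t - s)) A.
Proof.
move=> s0 st mA; rewrite -[LHS](congr1 P (setTI _)).
rewrite (am_increment hX s0 st _ mA); last exact: am_setT.
by rewrite probability_setT mul1e.
Qed.

Let mincr s t : measurable_fun setT (fun w => X t w - X s w).
Proof. by apply: measurable_funB; exact: am_measurable. Qed.

Let integral_law s t (f : R -> \bar R) : 0 <= s -> s < t ->
  measurable_fun setT f -> P.-integrable setT (f \o (fun w => X t w - X s w)) ->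
  (\int[P]_w f (X t w - X s w)%R = \int[normal_prob 0 (Num.sqrt (t - s))]_x f x)%E.
Proof.
move=> s0 st mf fi.
have := integral_pushforward
  (mincr s t : measurable_fun setT (_ : T -> measurableTypeR R)) mf fi measurableT.
rewrite preimage_setT => <-.
by apply: eq_measure_integral => [|mYf A mA _]; [exact: mincr|exact: law].
Qed.

Let ge0_integral_law s t (f : R -> \bar R) : 0 <= s -> s < t ->
  measurable_fun setT f -> (forall x, 0 <= f x)%E ->
  (\int[P]_w f (X t w - X s w)%R = \int[normal_prob 0 (Num.sqrt (t - s))]_x f x)%E.
Proof.
move=> s0 st mf f0.
have := ge0_integral_pushforward
  (mincr s t : measurable_fun setT (_ : T -> measurableTypeR R))
  P measurableT mf (fun x _ => f0 x).
rewrite preimage_setT => <-.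
by apply: eq_measure_integral => [|mYf A mA _]; [exact: mincr|exact: law].
Qed.

Let integral_sqr s t : 0 <= s -> s < t ->
  (\int[P]_w ((X t w - X s w) ^+ 2)%:E = (t - s)%:E)%E.
Proof.
move=> s0 st.
rewrite (ge0_integral_law (f := fun x => (x ^+ 2)%:E) s0 st); last 2 first.
- by apply/measurable_EFinP; apply: measurable_funX; exact: measurable_id.
- by move=> x; rewrite lee_fin sqr_ge0.
by rewrite normal_second_moment ?sqrtr_gt0 ?subr_gt0// sqr_sqrtr// subr_ge0 ltW.
Qed.

Lemma square_integrable_increment s t : 0 <= s -> s <= t ->
  square_integrable P (fun w => X t w - X s w).
Proof.
move=> s0; rewrite le_eqVlt => /predU1P[<-|st].
  have := @square_integrable_cst _ _ _ P 0.
  by congr square_integrable; apply/funext => w; rewrite subrr.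
split; first exact: mincr.
apply/integrableP; split.
  by apply/measurable_EFinP; apply: measurable_funX; exact: mincr.
under eq_integral do rewrite /= ger0_norm ?sqr_ge0//.
by rewrite integral_sqr// ltry.
Qed.

Lemma square_integrable_motion u : 0 <= u -> square_integrable P (X u).
Proof.
move=> u0; have := square_integrable_increment (lexx 0) u0.
by congr square_integrable; apply/funext => w; rewrite am_start// subr0.
Qed.

Lemma increment_mean s t : 0 <= s -> s < t ->
  \int[P]_w (X t w - X s w) = 0.
Proof.
move=> s0 st.
have i := square_integrable_integrable (square_integrable_increment s0 (ltW st)).
have st' : 0 < Num.sqrt (t - s) by rewrite sqrtr_gt0 subr_gt0.
rewrite /Rintegral (integral_law (f := EFin) s0 st) //.
by have := normal_mean st'; rewrite /Rintegral.
Qed.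

Let indep_fun s t (Z : T -> R) : 0 <= s -> s < t ->
  (forall A, measurable A -> F s (Z @^-1` A)) ->
  P.-integrable setT (EFin \o Z) ->
  P.-integrable setT (EFin \o (fun w => Z w * (X t w - X s w))) ->
  \int[P]_w (Z w * (X t w - X s w)) = 0.
Proof.
move=> s0 st FZ iZ iZY.
rewrite Rintegral_indep_mul//.
- by rewrite increment_mean// mulr0.
- apply: square_integrable_integrable.
  by apply: square_integrable_increment => //; exact: ltW.
- by move=> A C mA mC; rewrite law// am_increment//; exact: FZ.
Qed.

Let past_preimage s r (E : set T) (A : set R) : 0 <= r -> r <= s ->
  F s E -> measurable A -> F s ((fun w => \1_E w * X r w) @^-1` A).
Proof.
move=> r0 rs FE mA.
have FA : F s (X r @^-1` A) by apply: (am_mono hX rs); exact: am_adapted.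
(* Off [E] the product is 0, so the preimage contains the complement of [E] exactly when [A]
   contains 0. Either way it is built from [E] and the preimage under [X r] by intersections and
   differences. *)
have [A0|A0] := pselect (A 0).
  rewrite (_ : _ @^-1` _ = setT `\` (E `\` (X r @^-1` A))).
    by apply: (am_setD hX); [exact: am_setT|exact: am_setD].
  apply/seteqP; split => w /=; have [Ew|nEw] := pselect (E w).
  - by rewrite indicE mem_set// mul1r => Aw; split => // -[].
  - by move=> _; split => // -[].
  - by rewrite indicE mem_set// mul1r => -[_ h]; apply: contrapT => nA; exact: h.
  - by rewrite indicE memNset// mul0r.
rewrite (_ : _ @^-1` _ = E `&` (X r @^-1` A)); first exact: am_setI.
apply/seteqP; split => w /=; have [Ew|nEw] := pselect (E w).
- by rewrite indicE mem_set// mul1r.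
- by rewrite indicE memNset// mul0r.
- by rewrite indicE mem_set// mul1r => -[].
- by case.
Qed.

Lemma motion_orthogonal r s t E : 0 <= r -> r <= s -> s <= t -> F s E ->
  \int[P]_w (\1_E w * X r w * (X t w - X s w)) = 0.
Proof.
move=> r0 rs; rewrite le_eqVlt => /predU1P[<-|st] FE.
  under eq_Rintegral do rewrite subrr mulr0.
  by rewrite Rintegral_cst// mul0r.
have s0 := le_trans r0 rs; have mE := am_event hX FE.
have sZ := square_integrable_indicM mE (square_integrable_motion r0).
apply: indep_fun => //.
- by move=> A mA; exact: past_preimage.
- exact: square_integrable_integrable.
- apply: square_integrable_mul => //.
  by apply: square_integrable_increment => //; exact: ltW.
Qed.

Let past_indic s (E : set T) (A : set R) :
  F s E -> F s ((\1_E : T -> R) @^-1` A).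
Proof.
move=> FE; rewrite preimage_indic.
have FC B : F s B -> F s (~` B).
  by move=> FB; rewrite -setTD; apply: (am_setD hX) => //; exact: am_setT.
have FT := am_setT hX s.
have F0 : F s set0 by rewrite -setCT; exact: FC.
by do 2 case: ifP => _ //; exact: FC.
Qed.

Lemma increment_event_mean s t E : 0 <= s -> s <= t -> F s E ->
  \int[P]_w (\1_E w * (X t w - X s w)) = 0.
Proof.
move=> s0; rewrite le_eqVlt => /predU1P[<-|st] FE.
  under eq_Rintegral do rewrite subrr mulr0.
  by rewrite Rintegral_cst// mul0r.
have sE := square_integrable_indic P (am_event hX FE).
apply: indep_fun => //.
- by move=> A mA; exact: past_indic.
- exact: square_integrable_integrable.
- apply: square_integrable_mul => //.
  by apply: square_integrable_increment => //; exact: ltW.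
Qed.

Lemma increment_event_sqr s t E : 0 <= s -> s <= t -> F s E ->
  \int[P]_w (\1_E w * (X t w - X s w) ^+ 2) = (t - s) * fine (P E).
Proof.
move=> s0; rewrite le_eqVlt => /predU1P[<-|st] FE.
  under eq_Rintegral do rewrite subrr expr0n/= mulr0.
  by rewrite Rintegral_cst// subrr !mul0r.
have mE := am_event hX FE.
have iE := square_integrable_integrable (square_integrable_indic P mE).
have [_ iY] := square_integrable_increment s0 (ltW st).
rewrite Rintegral_indep_mul//.
- rewrite Rintegral_indic// mulrC; congr (_ * _).
  by rewrite /Rintegral integral_sqr.
- have := integrable_indicM mE iY; exact.
- move=> A C mA mC; pose C' := (fun x : R => x ^+ 2) @^-1` C.
  have mC' : measurable C'.
    rewrite /C' -[X in measurable X]setTI.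
    by apply: (measurable_funX 2 (@measurable_id _ R setT)).
  rewrite -[X in P (_ `&` X)]/((fun w => X t w - X s w) @^-1` C').
  rewrite -[X in (_ * P X)%E]/((fun w => X t w - X s w) @^-1` C').
  by rewrite law// am_increment//; exact: past_indic.
Qed.

(** The stochastic integral of the simple process equal to the indicator of [E j] on the j-th
    step. *)
Definition discrete_integral (t : nat -> R) (E : nat -> set T) (J : nat) (w : T) : R :=
  \sum_(j < J) \1_(E j) w * (X (t j.+1) w - X (t j) w).

Section discrete.
Variables (t : nat -> R) (E : nat -> set T).
Hypotheses (t0 : 0 <= t 0%N) (tS : forall j, t j <= t j.+1)
  (FE : forall j, F (t j) (E j)).

Let tmono i j : (i <= j)%N -> t i <= t j.
Proof.
apply: (homo_leq (f := t) (r := fun x y : R => x <= y)) => //.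
by move=> x y z; exact: le_trans.
Qed.

Let tge0 j : 0 <= t j. Proof. exact: le_trans t0 (tmono (leq0n j)). Qed.

Lemma square_integrable_discrete J : square_integrable P (discrete_integral t E J).
Proof.
apply: square_integrable_sum => j; apply: square_integrable_indicM.
  exact: am_event (FE j).
exact: square_integrable_increment.
Qed.

Lemma discrete_integral_mean J : \int[P]_w discrete_integral t E J w = 0.
Proof.
rewrite Rintegral_sum; last first.
  move=> j; apply: square_integrable_integrable.
  apply: square_integrable_indicM; first exact: am_event (FE j).
  exact: square_integrable_increment.
by apply: big1 => j _; exact: increment_event_mean.
Qed.

(** Both endpoints of the earlier increment, and the event [E l] as well as [E j], are known at time
    [t j]. Splitting that increment into its endpoint values gives two instances of
    [motion_orthogonal]. *)
Let cross l j : (l < j)%N ->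
  \int[P]_w (\1_(E l) w * (X (t l.+1) w - X (t l) w) *
            (\1_(E j) w * (X (t j.+1) w - X (t j) w))) = 0.
Proof.
move=> lj.
have FI : F (t j) (E l `&` E j).
  by apply: (am_setI hX) => //; apply: (am_mono hX) (FE l); exact/tmono/ltnW.
have mI := am_event hX FI.
have si r : 0 <= r -> P.-integrable setT (EFin \o
    (fun w => \1_(E l `&` E j) w * X r w * (X (t j.+1) w - X (t j) w))).
  move=> r0; apply: square_integrable_mul; last exact: square_integrable_increment.
  by apply: square_integrable_indicM => //; exact: square_integrable_motion.
rewrite (@eq_Rintegral _ _ _ P setT (fun w =>
  \1_(E l `&` E j) w * X (t l.+1) w * (X (t j.+1) w - X (t j) w) -
  \1_(E l `&` E j) w * X (t l) w * (X (t j.+1) w - X (t j) w))); last first.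
  by move=> w _; rewrite /= indicI /=; ring.
rewrite RintegralB//; [|exact: si|exact: si].
by rewrite !motion_orthogonal ?subr0//; apply: tmono => //; exact: ltnW.
Qed.

Lemma discrete_integral_sqr J : \int[P]_w (discrete_integral t E J w ^+ 2) =
  \sum_(j < J) (t j.+1 - t j) * fine (P (E j)).
Proof.
elim: J => [|J ih].
  under eq_Rintegral do rewrite /discrete_integral big_ord0 expr0n/=.
  by rewrite Rintegral_cst// mul0r big_ord0.
rewrite big_ord_recr -ih /=.
pose Dl := fun w => \1_(E J) w * (X (t J.+1) w - X (t J) w).
have sD : square_integrable P Dl.
  apply: square_integrable_indicM; first exact: am_event (FE J).
  exact: square_integrable_increment.
have sY := square_integrable_discrete J.
have iYD := square_integrable_mul sY sD.
rewrite (@eq_Rintegral _ _ _ P setT (fun w => discrete_integral t E J w ^+ 2 + Dl w ^+ 2 +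
   2 * (discrete_integral t E J w * Dl w))); last first.
  by move=> w _; rewrite /discrete_integral big_ord_recr /= -/(Dl w); ring.
rewrite RintegralD//; last 2 first.
- by apply: integrable_EFinD; [case: sY|case: sD].
- exact: integrable_EFinZ.
rewrite RintegralD//; [|by case: sY|by case: sD].
rewrite RintegralZl//.
have -> : \int[P]_w (discrete_integral t E J w * Dl w) = 0.
  rewrite (@eq_Rintegral _ _ _ P setT (fun w => \sum_(l < J)
    \1_(E l) w * (X (t l.+1) w - X (t l) w) * Dl w)); last first.
    by move=> w _; rewrite /discrete_integral mulr_suml.
  rewrite Rintegral_sum.
    by apply: big1 => l _; exact: cross.
  move=> l; apply: square_integrable_mul => //.
  apply: square_integrable_indicM; first exact: am_event (FE l).
  exact: square_integrable_increment.
rewrite mulr0 addr0; congr (_ + _).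
rewrite -increment_event_sqr//; apply: eq_Rintegral => w _.
rewrite /Dl exprMn indicE; case: (_ \in _); rewrite ?expr1n// expr0n/= !mul0r.
by [].
Qed.

End discrete.
End adapted_motion.

(** * Optional stopping *)

Section stopped_sums.
Context (R : realType).
Implicit Types (g : R -> R) (h x : R).

(* The sum of the increments of g over the grid steps that start before x: it
   telescopes to [g y - g 0], where y is the first grid point with [x <= y]. *)
Definition stopped_sum g h x (J : nat) : R :=
  \sum_(j < J) (j%:R * h < x)%R%:R * (g (j.+1%:R * h) - g (j%:R * h)).

(** [N] counts the steps starting before [x]: either all [J] of them do, or the count stops at the
    first grid point not below [x], an overshoot of less than [h]. *)
Lemma stopped_sumP g h x J : 0 < h -> 0 <= x ->
  exists N, [/\ (N <= J)%N, stopped_sum g h x J = g (N%:R * h) - g 0,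
    N%:R * h < x + h & N = J \/ x <= N%:R * h].
Proof.
move=> h0 x0; elim: J => [|J [N [NJ sE Nx NJx]]].
  exists 0%N; rewrite /stopped_sum big_ord0 mul0r subrr; split => //.
    by rewrite ltr_wpDl.
  by left.
rewrite /stopped_sum big_ord_recr /= -/(stopped_sum g h x J) sE.
have [Jx|xJ] := ltP (J%:R * h) x.
  have {}NJ : N = J.
    case: NJx => // xN; move: Jx; rewrite ltNge => /negP[].
    by apply: le_trans xN _; rewrite ler_pM2r// ler_nat.
  exists J.+1; split; [by []|by rewrite NJ mul1r addrC subrKA| |by left].
  by rewrite -natr1 mulrDl mul1r ltrD2r.
exists N; split => //; [exact: leqW|by rewrite mul0r addr0|].
by right; case: NJx => [->|].
Qed.

Lemma stopped_sum_lt g h x J : 0 < h -> J%:R * h <= x ->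
  stopped_sum g h x J = g (J%:R * h) - g 0.
Proof.
move=> h0; elim: J => [|J ih] Jx; first by rewrite /stopped_sum big_ord0 mul0r subrr.
have Jx' : J%:R * h < x by apply: lt_le_trans Jx; rewrite ltr_pM2r// ltr_nat.
rewrite /stopped_sum big_ord_recr /= -/(stopped_sum g h x J) ih ?ltW//.
by rewrite Jx' mul1r addrC subrKA.
Qed.

(* Squares add up because at most one of the indicators on the right is 1. *)
Lemma stopped_sum_error g h x J : 0 < h -> 0 < x ->
  (g x - g 0 - stopped_sum g h x J) ^+ 2 =
  \sum_(i < J) (i%:R * h < x <= i.+1%:R * h)%R%:R * (g (i.+1%:R * h) - g x) ^+ 2
  + (J%:R * h < x)%R%:R * (g x - g (J%:R * h)) ^+ 2.
Proof.
move=> h0 x0; elim: J => [|J ih].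
  by rewrite /stopped_sum !big_ord0 mul0r x0 subr0 add0r mul1r.
rewrite big_ord_recr /=.
have JJ1 : J%:R * h < J.+1%:R * h by rewrite ltr_pM2r// ltr_nat.
have [Jx|xJ] := ltP (J%:R * h) x; last first.
  rewrite /stopped_sum big_ord_recr /= -/(stopped_sum g h x J) ltNge xJ /=.
  rewrite mul0r addr0 ih ltNge xJ /= !mul0r !addr0 ltNge.
  by rewrite (le_trans xJ (ltW JJ1)) /= mul0r addr0.
rewrite big1 ?add0r; last first.
  move=> i _; rewrite [_ <= _ * _](_ : _ = false) ?andbF ?mul0r//.
  apply/negbTE; rewrite -ltNge; apply: le_lt_trans Jx.
  by rewrite ler_pM2r// ler_nat.
rewrite /stopped_sum big_ord_recr /= -/(stopped_sum g h x J) Jx mul1r.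
rewrite (stopped_sum_lt g h0 (ltW Jx)).
by have [xJ1|J1x] := leP x (J.+1%:R * h); rewrite /= ?mul1r ?mul0r ?addr0 ?add0r; ring.
Qed.

(** Once the grid reaches past [x], the sum telescopes to a grid point between [x] and [x + h n],
    and continuity of [g] concludes. *)
Lemma stopped_sum_cvg g x (J : nat -> nat) (h : nat -> R) : continuous g ->
  0 <= x -> (forall n, 0 < h n) -> h n @[n --> \oo] --> 0 ->
  (\forall n \near \oo, x <= (J n)%:R * h n) ->
  stopped_sum g (h n) x (J n) @[n --> \oo] --> g x - g 0.
Proof.
move=> cg x0 h0 hl Jx.
have ex n : exists y, stopped_sum g (h n) x (J n) = g y - g 0 /\
    (x <= (J n)%:R * h n -> x <= y <= x + h n).
  have [N [NJ -> Nx NJx]] := stopped_sumP g (J n) (h0 n) x0.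
  exists (N%:R * h n); split => // xJ; rewrite (ltW Nx) andbT.
  by case: NJx => [->|].
have [y hy] := choice ex.
have yx : y n @[n --> \oo] --> x.
  apply: (@squeeze_cvgr _ _ _ _ (fun=> x) (fun n => x + h n)).
  - near=> n; have [_] := hy n; apply; near: n; exact: Jx.
  - exact: cvg_cst.
  - by rewrite -[X in _ --> X]addr0; apply: cvgD => //; exact: cvg_cst.
rewrite (_ : (fun n => _) = (fun n => g (y n) - g 0)); last first.
  by apply/funext => n; have [] := hy n.
apply: cvgB; last exact: cvg_cst.
by apply: (cvg_comp y g yx); exact: cg.
Unshelve. all: by end_near. Qed.

End stopped_sums.

Section fatou_sqr.
Context d (T : measurableType d) (R : realType) (P : probability T R).

(** Fatou's lemma on the squares. Integrability of the limit is a conclusion, which is how stopped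
    values are shown to be square integrable in the first place. *)
Lemma square_integrable_lim (Y : nat -> T -> R) (D : T -> R) (b : nat -> R) c :
  (forall n, square_integrable P (Y n)) ->
  (forall w, Y n w @[n --> \oo] --> D w) ->
  (forall n, \int[P]_w (Y n w ^+ 2) <= b n) ->
  b n @[n --> \oo] --> c ->
  square_integrable P D /\ \int[P]_w (D w ^+ 2) <= c.
Proof.
move=> sY YD Yb bc.
have mD : measurable_fun setT D.
  apply: (@measurable_fun_cvg _ _ _ _ Y) => [n|w _]; last exact: YD.
  by case: (sY n).
have mY n : measurable_fun setT (fun w => (Y n w ^+ 2)%:E).
  by apply/measurable_EFinP; apply: measurable_funX; case: (sY n).
have Ybe n : (\int[P]_w (Y n w ^+ 2)%:E <= (b n)%:E)%E.
  by rewrite -EFin_Rintegral ?lee_fin//; case: (sY n).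
have Y0 n w : [set: T] w -> (0 <= (Y n w ^+ 2)%:E)%E.
  by rewrite lee_fin sqr_ge0.
have fat : (\int[P]_w (D w ^+ 2)%:E <= c%:E)%E.
  rewrite (_ : integral _ _ _ = (\int[P]_w limn_einf (fun n => (Y n w ^+ 2)%:E))%E).
    apply: le_trans (fatou P measurableT mY Y0) _.
    rewrite limn_einf_lim.
    have bce : (fun n => (b n)%:E) @ \oo --> c%:E by apply: cvg_EFin => //; exact: nearW.
    rewrite -(cvg_lim _ bce)//; apply: lee_lim.
    - exact: is_cvg_einfs.
    - by apply/cvg_ex; exists c%:E.
    - apply: nearW => n; apply: le_trans (Ybe n); apply: ereal_inf_lbound.
      by exists n => /=.
  apply: eq_integral => w _; apply/esym.
  have /cvg_limn_einf_sup[-> //] : (Y n w ^+ 2)%:E @[n --> \oo] --> (D w ^+ 2)%:E.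
  apply: cvg_EFin; first exact: nearW.
  have D2 : Y n w ^+ 2 @[n --> \oo] --> D w ^+ 2.
    by rewrite expr2; under eq_fun do rewrite expr2; apply: cvgM; exact: YD.
  exact: D2.
have iD : P.-integrable setT (EFin \o (fun w => D w ^+ 2)).
  apply/integrableP; split.
    by apply/measurable_EFinP; exact: measurable_funX.
  under eq_integral do rewrite /= ger0_norm ?sqr_ge0//.
  by apply: le_lt_trans fat _; rewrite ltry.
by split => //; rewrite -lee_fin EFin_Rintegral.
Qed.
End fatou_sqr.

Lemma le_harmonic (R : realType) (a b c : R) :
  (forall k : nat, a <= b + c / k.+1%:R) -> a <= b.
Proof.
move=> h; have hb : b + c / k.+1%:R @[k --> \oo] --> b.
  rewrite -[X in _ --> X]addr0 -[X in _ + X](mulr0 c).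
  apply: cvgD; first exact: cvg_cst.
  by apply: cvgM; [exact: cvg_cst|exact: cvg_harmonic].
rewrite -(cvg_lim _ hb)//; apply: limr_ge; first by apply/cvg_ex; exists b.
exact: nearW.
Qed.

Section optional_stopping.
Context d (T : measurableType d) (R : realType) (P : probability T R).
Variables (X : R -> T -> R) (F : R -> set_system T) (tau : T -> R).
Hypotheses (hX : adapted_motion P X F) (tau_ge0 : forall w, 0 <= tau w)
  (stau : square_integrable P tau)
  (Ftau : forall u, 0 <= u -> F u [set w | u < tau w]).

Local Notation after u := [set w : T | u < tau w].
Local Notation XT := (fun w => X (tau w) w).

Let mtau : measurable_fun setT tau. Proof. by case: stau. Qed.

Let indic_after (E : set T) u h w :
  \1_(E `&` after (u + h)) w = \1_E w * (h < tau w - u)%R%:R :> R.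
Proof.
rewrite indicI /=; congr (_ * _); rewrite indicE; congr ((nat_of_bool _)%:R).
by apply/idP/idP; rewrite inE /= ltrBrDl.
Qed.

Let FA u v E : 0 <= u -> u <= v -> F u E -> F v (E `&` after v).
Proof.
move=> u0 uv FE; apply: (am_setI hX); first exact: (am_mono hX uv).
by apply: Ftau; exact: le_trans uv.
Qed.

Section grid.
Variables (u h : R) (E : set T).
Hypotheses (u0 : 0 <= u) (h0 : 0 < h) (FE : F u E).

Let t j := u + j%:R * h.
Let A j := E `&` after (t j).

Let t0 : 0 <= t 0%N. Proof. by rewrite /t mul0r addr0. Qed.
Let ut j : u <= t j. Proof. by rewrite /t lerDl mulr_ge0// ltW. Qed.
Let tS j : t j <= t j.+1. Proof. by rewrite /t lerD2l ler_pM2r// ler_nat. Qed.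
Let FAj j : F (t j) (A j). Proof. exact: (FA u0 (ut j) FE). Qed.

(** On [E], when [u < tau], this is the increment of [X] from [u] to [tau] rounded up to the grid
    and capped at step [J]. Each step is kept according to an event known when it starts, which
    makes it a discrete integral. *)
Definition grid_sum J : T -> R := discrete_integral X t A J.

Lemma square_integrable_grid_sum J : square_integrable P (grid_sum J).
Proof. exact: (square_integrable_discrete hX t0 tS FAj). Qed.

Lemma grid_sum_mean J : \int[P]_w grid_sum J w = 0.
Proof. exact: (discrete_integral_mean hX t0 tS FAj). Qed.

Lemma grid_sumE J w : grid_sum J w =
  \1_E w * stopped_sum (fun y => X (u + y) w) h (tau w - u) J.
Proof.
rewrite /grid_sum /discrete_integral /stopped_sum mulr_sumr.
by apply: eq_bigr => j _; rewrite /A /t indic_after mulrA.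
Qed.

Let mA j : measurable (A j). Proof. exact: (am_event hX (FAj j)). Qed.

Let grid_countE J : (fun w => \1_E w * stopped_sum id h (tau w - u) J) =
  (fun w => \sum_(j < J) h * \1_(A j) w).
Proof.
apply/funext => w; rewrite /stopped_sum mulr_sumr; apply: eq_bigr => j _.
by rewrite /A /t indic_after -natr1; ring.
Qed.

Let integrable_grid_term j : P.-integrable setT (EFin \o (\1_(A j) : T -> R)).
Proof. by apply: square_integrable_integrable; exact: square_integrable_indic. Qed.

Lemma integrable_grid_count J : P.-integrable setT
  (EFin \o (fun w => \1_E w * stopped_sum id h (tau w - u) J)).
Proof.
rewrite grid_countE; apply: square_integrable_integrable.
apply: square_integrable_sum => j; apply: square_integrableZ.
exact: square_integrable_indic.
Qed.

(** The isometry gives the sum of [h] times the probabilities of the [A j], and this is the mean of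
    the rounded duration: [stopped_sum id] applies the same rounding to the clock itself. *)
Lemma grid_sum_sqr J : \int[P]_w (grid_sum J w ^+ 2) =
  \int[P]_w (\1_E w * stopped_sum id h (tau w - u) J).
Proof.
rewrite grid_countE (discrete_integral_sqr hX t0 tS FAj) Rintegral_sum; last first.
  by move=> j; exact: integrable_EFinZ.
apply: eq_bigr => j _; rewrite RintegralZl// Rintegral_indic//; congr (_ * _).
by rewrite /t -natr1; ring.
Qed.
End grid.

(** Grid sums converge on each path by continuity, and their second moments are mean rounded
    durations, which exceed the true one by at most the mesh. *)
Lemma square_integrable_stopped_increment u E : 0 <= u -> F u E ->
  square_integrable P (fun w => \1_(E `&` after u) w * (XT w - X u w)) /\
  \int[P]_w ((\1_(E `&` after u) w * (XT w - X u w)) ^+ 2) <=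
  \int[P]_w (\1_(E `&` after u) w * (tau w - u)).
Proof.
move=> u0 FE.
(* Mesh 1/(n+1) with (n+1)^2 steps: the grid refines while its length n+1 tends to infinity. *)
pose h (n : nat) : R := n.+1%:R^-1; pose J n := (n.+1 * n.+1)%N.
have h0 n : 0 < h n by rewrite /h invr_gt0 ltr0n.
have Jh n : (J n)%:R * h n = n.+1%:R.
  by rewrite /J /h natrM mulfK// pnatr_eq0.
have hl : h n @[n --> \oo] --> 0 by exact: cvg_harmonic.
have mE : measurable E by exact: (am_event hX FE).
have mG : measurable (E `&` after u) by exact: (am_event hX (FA u0 (lexx u) FE)).
have indG w : \1_(E `&` after u) w = \1_E w * (0 < tau w - u)%R%:R :> R.
  by rewrite -indic_after addr0.
have stu : square_integrable P (fun w => tau w - u).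
  by apply: square_integrableB => //; exact: square_integrable_cst.
have sG := square_integrable_indicM mG stu.
pose c := \int[P]_w (\1_(E `&` after u) w * (tau w - u)).
apply: (@square_integrable_lim _ _ _ _ (fun n => grid_sum u (h n) E (J n)) _
  (fun n => c + h n)).
- by move=> n; exact: square_integrable_grid_sum.
- move=> w; under eq_fun do rewrite grid_sumE.
  rewrite indG -mulrA; apply: cvgM; first exact: cvg_cst.
  have [x0|x0] := ltP 0 (tau w - u).
    rewrite mul1r.
    have -> : X (tau w) w - X u w = (fun y => X (u + y) w) (tau w - u) -
        (fun y => X (u + y) w) 0 by rewrite /= subrKC addr0.
    apply: stopped_sum_cvg => //.
    + move=> y; apply: (cvg_comp (fun y => u + y) (X ^~ w)).
        by apply: cvgD; [exact: cvg_cst|exact: cvg_id].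
      exact: (am_continuous hX).
    + exact: ltW.
    + near=> n; rewrite Jh; apply: (@le_trans _ _ n%:R); last by rewrite ler_nat.
      by near: n; exact: nbhs_infty_ger.
  rewrite mul0r (_ : (fun n => _) = cst 0); first exact: cvg_cst.
  apply/funext => n; rewrite /stopped_sum big1// => j _.
  by rewrite ltNge (le_trans x0) ?mulr_ge0 ?mul0r// ltW.
- move=> n; rewrite grid_sum_sqr//.
  have -> : c + h n = \int[P]_w (\1_(E `&` after u) w * (tau w - u) + h n).
    rewrite RintegralD//; last 2 first.
    - exact: square_integrable_integrable.
    - exact: integrable_EFin_cst.
    by rewrite Rintegral_cstP.
  apply: le_Rintegral => //.
  - exact: integrable_grid_count.
  - apply: integrable_EFinD; last exact: integrable_EFin_cst.
    exact: square_integrable_integrable.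
  - move=> w _; rewrite indG.
    have [x0|x0] := ltP 0 (tau w - u); last first.
      rewrite mulr0 mul0r add0r /stopped_sum big1 ?mulr0 ?ltW// => j _.
      by rewrite ltNge (le_trans x0) ?mulr_ge0 ?mul0r// ltW.
    have [N [_ -> Nx _]] := stopped_sumP id (J n) (h0 n) (ltW x0).
    rewrite subr0 mulr1 indicE; case: (_ \in _); rewrite ?mul1r ?mul0r ?add0r//.
      exact: ltW.
    exact: ltW.
- by rewrite -[X in _ --> X]addr0; apply: cvgD => //; exact: cvg_cst.
Unshelve. all: by end_near. Qed.

Let indic_until (E : set T) u h w :
  \1_(E `\` after (u + h)) w = \1_E w * (1 - (h < tau w - u)%R%:R) :> R.
Proof.
rewrite mulrBr mulr1 -indic_after setDE !indicI indicC /= !indicE.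
rewrite -{2}[(w \in E)%:R]mulr1 -mulrBr.
by congr (_ * _); case: (w \in after _); rewrite /= ?subrr ?subr0.
Qed.

(* [(E `&` after s) `\` after t] is E on the event [s < tau <= t]. *)
Lemma square_integrable_final_increment s t E : 0 <= s -> s < t -> F s E ->
  square_integrable P
    (fun w => \1_((E `&` after s) `\` after t) w * (X t w - XT w)) /\
  \int[P]_w ((\1_((E `&` after s) `\` after t) w * (X t w - XT w)) ^+ 2) <=
  (t - s) * fine (P ((E `&` after s) `\` after t)).
Proof.
move=> s0 st FE; have ts : 0 < t - s by rewrite subr_gt0.
pose A := E `&` after s; rewrite -/A.
have FsA : F s A by exact: (FA s0 (lexx s) FE).
pose h (n : nat) : R := (t - s) / n.+1%:R.
have h0 n : 0 < h n by rewrite /h divr_gt0// ltr0n.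
have Jh n : n.+1%:R * h n = t - s by rewrite /h mulrC divfK// pnatr_eq0.
have hl : h n @[n --> \oo] --> 0.
  rewrite -[X in _ --> X](mulr0 (t - s)).
  by apply: cvgM; [exact: cvg_cst|exact: cvg_harmonic].
pose u n j := s + j%:R * h n.
(* The complementary choice of steps, those starting at or after [tau]. As the grid ends exactly at
   [t], their increments add up to [X t] minus [X] at the rounded [tau]. *)
pose C n j := A `\` after (u n j).
have u0 n : 0 <= u n 0%N by rewrite /u mul0r addr0.
have uS n j : u n j <= u n j.+1 by rewrite /u lerD2l ler_pM2r// ler_nat.
have su n j : s <= u n j by rewrite /u lerDl mulr_ge0// ltW.
have FC n j : F (u n j) (C n j).
  apply: (am_setD hX); first exact: (am_mono hX (su n j)).
  by apply: Ftau; exact: le_trans (su n j).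
have FG : F t (A `\` after t).
  apply: (am_setD hX); first exact: (am_mono hX (ltW st)).
  by apply: Ftau; exact/ltW/(le_lt_trans s0).
have mC n j : measurable (C n j) by exact: (am_event hX (FC n j)).
have mG : measurable (A `\` after t) by exact: (am_event hX FG).
have YE n w : discrete_integral X (u n) (C n) n.+1 w = \1_A w *
    (X t w - X s w - stopped_sum (fun y => X (s + y) w) (h n) (tau w - s) n.+1).
  have -> : X t w - X s w =
      \sum_(j < n.+1) (X (s + j.+1%:R * h n) w - X (s + j%:R * h n) w).
    rewrite -(big_mkord xpredT (fun j => X (s + j.+1%:R * h n) w - X (s + j%:R * h n) w)).
    rewrite (telescope_sumr (fun j => X (s + j%:R * h n) w))// Jh mul0r addr0.
    by rewrite subrKC.
  rewrite /stopped_sum -sumrB mulr_sumr; apply: eq_bigr => j _.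
  by rewrite /C /u indic_until; ring.
have FGE w : \1_(A `\` after t) w = \1_A w * (1 - (t - s < tau w - s)%R%:R) :> R.
  by rewrite -indic_until subrKC.
apply: (@square_integrable_lim _ _ _ _
  (fun n => discrete_integral X (u n) (C n) n.+1) _
  (fun=> (t - s) * fine (P (A `\` after t)))).
- by move=> n; exact: (square_integrable_discrete hX).
- move=> w; under eq_fun do rewrite YE.
  rewrite FGE -mulrA.
  have [Aw|nAw] := pselect (A w); last first.
    rewrite indicE memNset// mul0r (_ : (fun n => _) = cst 0); first exact: cvg_cst.
    by apply/funext => n; rewrite mul0r.
  apply: cvgM; first exact: cvg_cst.
  have x0 : 0 < tau w - s by case: Aw => _ /=; rewrite subr_gt0.
  have [xt|tx] := ltP (t - s) (tau w - s).
    rewrite subrr mul0r; apply: cvg_near_cst; apply: nearW => n.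
    by rewrite stopped_sum_lt ?Jh ?ltW// addr0 subrKC subrr.
  rewrite subr0 mul1r.
  rewrite (_ : X t w - X (tau w) w = X t w - X s w -
    ((fun y => X (s + y) w) (tau w - s) - (fun y => X (s + y) w) 0)); last first.
    by rewrite /= subrKC addr0; ring.
  apply: cvgB; first exact: cvg_cst.
  apply: stopped_sum_cvg => //.
  + move=> y; apply: (cvg_comp (fun y => s + y) (X ^~ w)).
      by apply: cvgD; [exact: cvg_cst|exact: cvg_id].
    exact: (am_continuous hX).
  + exact: ltW.
  + by apply: nearW => n; rewrite Jh.
- move=> n; rewrite (discrete_integral_sqr hX (u0 n) (uS n) (FC n)).
  (* Every [C n j] lies in [E] on the event s < tau <= t, and the [n.+1] steps have total length
     [t - s]. *)
  apply: (@le_trans _ _ (\sum_(j < n.+1) h n * fine (P (A `\` after t)))).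
    apply: ler_sum => j _; rewrite (_ : u n j.+1 - u n j = h n); last first.
      by rewrite /u -natr1; ring.
    rewrite ler_pM2l// fine_le ?fin_num_measure// le_measure ?inE//.
    move=> w [Aw nw]; split => // tw; apply: nw => /=; apply: le_lt_trans tw.
    rewrite /u -lerBrDl -(Jh n) ler_pM2r// ler_nat; exact: ltnW.
  by rewrite sumr_const card_ord -mulr_natl mulrA Jh.
- exact: cvg_cst.
Qed.

(** By [stopped_sum_error] the squared error is exactly a sum of terms [L i], for [tau] inside step
    i, and one term [M], for [tau] beyond the grid. The two preceding lemmas bound their means. *)
Lemma grid_sum_error u E (m : nat) : 0 <= u -> F u E -> (0 < m)%N ->
  \int[P]_w ((\1_(E `&` after u) w * (XT w - X u w) -
     grid_sum u m%:R^-1 E (m * m) w) ^+ 2) <=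
  (1 + \int[P]_w (tau w ^+ 2)) / m%:R.
Proof.
move=> u0 FE m0; pose h : R := m%:R^-1; rewrite -/h; set J := (m * m)%N.
have mR : 0 < m%:R :> R by rewrite ltr0n.
have h0 : 0 < h by rewrite invr_gt0.
have Jh : J%:R * h = m%:R by rewrite /J /h natrM mulfK// gt_eqF.
pose t i := u + i%:R * h.
have ut i : u <= t i by rewrite /t lerDl mulr_ge0// ltW.
have t0 i : 0 <= t i by exact: le_trans (ut i).
have tS i : t i < t i.+1 by rewrite /t ltrD2l ltr_pM2r// ltr_nat.
have FtE i : F (t i) E by exact: (am_mono hX (ut i)).
pose A i := E `&` after (t i).
have mA i : measurable (A i).
  by apply: (am_event hX); exact: (FA (t0 i) (lexx _) (FtE i)).
pose L i w := \1_(A i `\` after (t i.+1)) w * (X (t i.+1) w - XT w).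
pose M w := \1_(A J) w * (XT w - X (t J) w).
have LE i := square_integrable_final_increment (t0 i) (tS i) (FtE i).
have ME := square_integrable_stopped_increment (t0 J) (FtE J).
have iL i : P.-integrable setT (EFin \o (fun w => L i w ^+ 2)) by case: (LE i) => -[].
have iM : P.-integrable setT (EFin \o (fun w => M w ^+ 2)) by case: ME => -[].
have errE w : (\1_(E `&` after u) w * (XT w - X u w) - grid_sum u h E J w) ^+ 2 =
    \sum_(i < J) L i w ^+ 2 + M w ^+ 2.
  pose g y := X (u + y) w.
  have XE : XT w - X u w = g (tau w - u) - g 0 by rewrite /g subrKC addr0.
  have uE : \1_(E `&` after u) w = \1_E w * (0 < tau w - u)%R%:R :> R.
    by rewrite -indic_after addr0.
  have LwE i : L i w = \1_E w * (i%:R * h < tau w - u <= i.+1%:R * h)%R%:R *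
      (g (i.+1%:R * h) - g (tau w - u)).
    rewrite /L /A /t indic_until indic_after /g subrKC -!mulrA; congr (_ * _).
    rewrite mulrA ltNge; case: ltP => _; case: leP => _;
      by rewrite /= ?subr0 ?subrr ?mulr1 ?mulr0.
  have MwE : M w = \1_E w * (J%:R * h < tau w - u)%R%:R *
      (g (tau w - u) - g (J%:R * h)).
    by rewrite /M /A /t indic_after /g subrKC.
  rewrite grid_sumE XE uE MwE; under eq_bigr do rewrite LwE.
  have sqb (b : bool) : (b%:R : R) ^+ 2 = b%:R by case: b; rewrite ?expr1n ?expr0n.
  have [Ew|nEw] := pselect (E w); last first.
    rewrite indicE memNset// !mul0r subrr expr0n/= addr0 big1// => i _.
    by rewrite !mul0r expr0n.
  rewrite indicE mem_set// !mul1r.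
  have [x0|x0] := ltP 0 (tau w - u).
    rewrite mul1r stopped_sum_error// !exprMn sqb; congr (_ + _).
    by apply: eq_bigr => i _; rewrite mul1r exprMn sqb.
  have xh i : (i%:R * h < tau w - u) = false.
    by apply/negbTE; rewrite -leNgt (le_trans x0)// mulr_ge0// ltW.
  rewrite mul0r /stopped_sum !big1 ?xh ?mul0r ?subrr ?expr0n/= ?addr0//.
    by move=> i _; rewrite xh mul1r mul0r expr0n.
  by move=> i _; rewrite xh mul0r.
under eq_Rintegral do rewrite errE.
rewrite RintegralD//; last first.
  have := @integrable_sum _ T R P setT measurableT _ (index_enum 'I_J) xpredT
    (fun i => EFin \o (fun w => L i w ^+ 2)) (fun i _ => iL i).
  by congr (_.-integrable _ _); apply/funext => w /=; rewrite sumEFin.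
rewrite Rintegral_sum; last by move=> i; exact: iL.
have boundL : \sum_(i < J) \int[P]_w (L i w ^+ 2) <= h.
  (* The difference is the probability of [E] with [tau] in step i; these telescope to at most 1. *)
  apply: (@le_trans _ _ (\sum_(i < J) h * (fine (P (A i)) - fine (P (A i.+1))))).
    apply: ler_sum => i _; have [_] := LE i; move=> /le_trans; apply.
    rewrite (_ : t i.+1 - t i = h); last by rewrite /t -natr1; ring.
    rewrite ler_pM2l// (_ : _ `\` _ = A i `\` A i.+1); last first.
      apply/seteqP; split => w [[Ew Aw] nw]; split => //; first by case.
      by move=> tw; apply: nw; split.
    rewrite measureD//; last by rewrite ltey_eq fin_num_measure.
    rewrite (setIidr _); last first.
      by move=> w [Ew tw]; split => //; exact: lt_trans tw.
    by rewrite fineB// fin_num_measure.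
  rewrite -mulr_sumr -[leRHS]mulr1 ler_pM2l//.
  rewrite -(big_mkord xpredT (fun i => fine (P (A i)) - fine (P (A i.+1)))).
  rewrite -(opprK (\sum_(_ <= _ < _) _)) -sumrN.
  under eq_bigr do rewrite opprB.
  rewrite (telescope_sumr (fun i => fine (P (A i))))// opprB.
  rewrite lerBlDr (le_trans (_ : _ <= 1))//.
    rewrite -[leRHS]/(fine 1%E) fine_le ?fin_num_measure//.
    exact: probability_le1.
  by rewrite lerDl fine_ge0.
have boundM : \int[P]_w (M w ^+ 2) <= (\int[P]_w (tau w ^+ 2)) * h.
  case: ME => _ /le_trans; apply.
  have [_ itau2] := stau.
  rewrite mulrC -RintegralZl//; apply: le_Rintegral => //.
  - apply: square_integrable_integrable; apply: square_integrable_indicM => //.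
      exact: mA.
    by apply: square_integrableB => //; exact: square_integrable_cst.
  - exact: integrable_EFinZ.
  - move=> w _; rewrite /t indic_after Jh.
    have [x0|x0] := ltP m%:R (tau w - u); last first.
      by rewrite mulr0 mul0r mulr_ge0 ?sqr_ge0// ltW.
    (* Because m tau <= m^2 + tau^2 and [u] is nonnegative. *)
    have tm : tau w - (u + m%:R) <= h * tau w ^+ 2.
      rewrite /h mulrC ler_pdivlMr//.
      have := tau_ge0 w; nra.
    rewrite mulr1 indicE; case: (_ \in _); rewrite ?mul1r// mul0r.
    by rewrite mulr_ge0 ?sqr_ge0// ltW.
by rewrite mulrDl mul1r lerD.
Qed.

(** Paths with [tau w = 0] are dropped by the indicator at no cost, since [X 0] vanishes. So the
    stopped value is the case [u = 0], [E = setT] of the stopped increments. *)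
Let stopped_startE w : \1_(setT `&` after 0) w * (XT w - X 0 w) = XT w.
Proof.
rewrite setTI (am_start hX) subr0 indicE.
have [t0|] := ltP 0 (tau w); first by rewrite mem_set// mul1r.
move=> t0; have -> : tau w = 0 by apply/eqP; rewrite eq_le t0 tau_ge0.
by rewrite (am_start hX) mulr0.
Qed.

Lemma square_integrable_stopped : square_integrable P XT.
Proof.
have [+ _] := square_integrable_stopped_increment (lexx 0) (am_setT hX 0).
by congr square_integrable; apply/funext => w; exact: stopped_startE.
Qed.

(** Grid sums have mean 0. Their squared error is turned into a bound on means by c z <= 1/a + a
    z^2, where c is 1 or -1, in place of Cauchy-Schwarz; the two signs give the two inequalities. *)
Lemma stopped_event_mean u E : 0 <= u -> F u E ->
  \int[P]_w (\1_(E `&` after u) w * (XT w - X u w)) = 0.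
Proof.
move=> u0 FE; set D := fun w => \1_(E `&` after u) w * (XT w - X u w).
have [sD _] : square_integrable P D /\ _ := square_integrable_stopped_increment u0 FE.
set K := 1 + \int[P]_w (tau w ^+ 2).
have K0 : 0 <= K by rewrite addr_ge0// Rintegral_ge0// => w _; rewrite sqr_ge0.
(* Mesh 1/(k+1)^2, because the squared error is multiplied by k+1 below and must still vanish. *)
pose Y (k : nat) := grid_sum u (k.+1 * k.+1)%:R^-1 E (k.+1 * k.+1 * (k.+1 * k.+1)).
have h0 (k : nat) : 0 < (k.+1 * k.+1)%:R^-1 :> R by rewrite invr_gt0 ltr0n.
have sY k : square_integrable P (Y k) by exact: square_integrable_grid_sum.
have sZ k := square_integrableB sD (sY k).
have DE k : \int[P]_w D w = \int[P]_w (D w - Y k w).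
  rewrite RintegralB//; [|exact: square_integrable_integrable..].
  by rewrite grid_sum_mean// subr0.
have bound k (c : R) : c ^+ 2 = 1 -> c * \int[P]_w D w <= (1 + K) / k.+1%:R.
  move=> c1; rewrite (DE k).
  have iZ := square_integrable_integrable (sZ k).
  have [_ iZ2] := sZ k.
  rewrite -RintegralZl//.
  apply: (@le_trans _ _ (\int[P]_w (k.+1%:R^-1 + k.+1%:R * (D w - Y k w) ^+ 2))).
    apply: le_Rintegral => //.
    - exact: integrable_EFinZ.
    - by apply: integrable_EFinD; [exact: integrable_EFin_cst|exact: integrable_EFinZ].
    - move=> w _; set z := D w - Y k w; set a := k.+1%:R.
      have a0 : 0 < a by rewrite ltr0n.
      have -> : c * z = a^-1 * (c * (a * z)) by field; rewrite gt_eqF.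
      have -> : a^-1 + a * z ^+ 2 = a^-1 * (c ^+ 2 + (a * z) ^+ 2).
        by rewrite c1; field; rewrite gt_eqF.
      rewrite ler_pM2l ?invr_gt0//.
      by have := sqr_ge0 (c - a * z); nra.
  rewrite RintegralD//; [|exact: integrable_EFin_cst|exact: integrable_EFinZ].
  rewrite Rintegral_cstP RintegralZl// mulrDl mul1r lerD2l.
  have := grid_sum_error u0 FE (ltn0Sn (k.+1 * k.+1).-1).
  rewrite -/K -(prednK (n := (k.+1 * k.+1)%N))// => err.
  apply: le_trans (_ : k.+1%:R * (K / (k.+1 * k.+1)%:R) <= _).
    by rewrite ler_pM2l ?ltr0n.
  by rewrite natrM invfM mulrCA !mulrA mulfK// mulrC.
have lim (a : R) : (forall k : nat, a <= (1 + K) / k.+1%:R) -> a <= 0.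
  by move=> h; apply: (@le_harmonic _ _ _ (1 + K)) => k; rewrite add0r.
apply/eqP; rewrite eq_le; apply/andP; split.
  by apply: lim => k; rewrite -[leLHS]mul1r; apply: bound; rewrite expr1n.
rewrite -oppr_le0; apply: lim => k; rewrite -mulN1r; apply: bound.
by rewrite sqrrN expr1n.
Qed.

Lemma stopped_mean : \int[P]_w XT w = 0.
Proof.
under eq_Rintegral do rewrite -stopped_startE.
exact: stopped_event_mean (am_setT hX 0).
Qed.

(** One inequality is the Fatou bound. For the other, the grid sum has second moment close to the
    mean of [tau], and its square is compared with that of the stopped value by a weighted Young
    inequality. *)
Lemma stopped_sqr_mean : \int[P]_w (XT w ^+ 2) = \int[P]_w tau w.
Proof.
have sXT := square_integrable_stopped.
have itau := square_integrable_integrable stau.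
have [_ itau2] := stau; have [_ iXT2] := sXT.
set K := \int[P]_w (tau w ^+ 2).
set a := \int[P]_w (XT w ^+ 2); set b := \int[P]_w tau w.
have K0 : 0 <= K by apply: Rintegral_ge0 => w _; rewrite sqr_ge0.
have a0 : 0 <= a by apply: Rintegral_ge0 => w _; rewrite sqr_ge0.
apply/eqP; rewrite eq_le; apply/andP; split.
  have [_] := square_integrable_stopped_increment (lexx 0) (am_setT hX 0).
  under eq_Rintegral do rewrite stopped_startE.
  move=> /le_trans; apply; rewrite le_eqVlt; apply/orP; left; apply/eqP.
  apply: eq_Rintegral => w _; rewrite setTI subr0 indicE.
  have [t0|t0] := ltP 0 (tau w); first by rewrite mem_set// mul1r.
  rewrite memNset ?mul0r; last by move=> /=; rewrite ltNge t0.
  by apply/eqP; rewrite eq_le t0 tau_ge0.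
(* The constant collects three errors of order 1/q: [a] from the weight 1/q in [up], [2 * (1 + K)]
   from (1 + q) times the grid error of order 1/q^2, and [K] from [low]. *)
apply: (@le_harmonic _ _ _ (a + 2 * (1 + K) + K)) => k.
set q : R := k.+1%:R; have q0 : 0 < q by rewrite ltr0n.
have q1 : 1 <= q by rewrite ler1n.
pose m := (k.+1 * k.+1)%N; pose J := (m * m)%N; pose h : R := m%:R^-1.
have mE : m%:R = q * q by rewrite /m natrM.
have m0 : 0 < m%:R :> R by rewrite mE mulr_gt0.
have h0 : 0 < h by rewrite invr_gt0.
have Jh : J%:R * h = m%:R by rewrite /J /h natrM mulfK// gt_eqF.
pose Y := grid_sum 0 h setT J.
have FT := am_setT hX 0.
have sY : square_integrable P Y by exact: square_integrable_grid_sum.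
have [_ iY2] := sY.
have sZ := square_integrableB sXT sY.
have [_ iZ2] := sZ.
have err : \int[P]_w ((XT w - Y w) ^+ 2) <= (1 + K) / m%:R.
  have := grid_sum_error (lexx 0) FT (ltn0Sn (m.-1)).
  by under eq_Rintegral do rewrite stopped_startE.
have low : b - K / m%:R <= \int[P]_w (Y w ^+ 2).
  rewrite /Y grid_sum_sqr//.
  have -> : b - K / m%:R = \int[P]_w (tau w - h * tau w ^+ 2).
    by rewrite RintegralB//; [rewrite RintegralZl// mulrC|exact: integrable_EFinZ].
  apply: le_Rintegral => //.
  - by apply: integrable_EFinB => //; exact: integrable_EFinZ.
  - exact: integrable_grid_count.
  - move=> w _; rewrite indicT mul1r subr0.
    (* Either the rounded time is at least [tau], or it is capped at m, and then tau - tau^2/m <=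
       m. *)
    have [N [_ -> _ NJ]] := stopped_sumP id J h0 (tau_ge0 w).
    have ht2 : 0 <= h * tau w ^+ 2 by rewrite mulr_ge0 ?sqr_ge0// ltW.
    rewrite subr0; case: NJ => [->|Nx]; last by rewrite lerBlDr (le_trans Nx)// lerDl.
    rewrite Jh -(ler_pM2l m0) mulrBr /h mulrA mulfV ?gt_eqF// mul1r.
    by have := sqr_ge0 (tau w - m%:R); have := tau_ge0 w; nra.
have up : \int[P]_w (Y w ^+ 2) <= (1 + q^-1) * a + (1 + q) * ((1 + K) / m%:R).
  apply: (@le_trans _ _ (\int[P]_w ((1 + q^-1) * XT w ^+ 2 +
      (1 + q) * (XT w - Y w) ^+ 2))).
    apply: le_Rintegral => //.
      by apply: integrable_EFinD; exact: integrable_EFinZ.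
    move=> w _; set x := XT w; set z := x - Y w.
    have -> : Y w = x - z by rewrite /z; ring.
    have -> : (1 + q^-1) * x ^+ 2 + (1 + q) * z ^+ 2 =
        (x - z) ^+ 2 + q^-1 * (x + q * z) ^+ 2 by field; rewrite gt_eqF.
    by rewrite lerDl mulr_ge0 ?sqr_ge0// invr_ge0 ltW.
  rewrite RintegralD//; [|exact: integrable_EFinZ..].
  by rewrite !RintegralZl// lerD2l ler_pM2l// ltr_wpDr// ltW.
have := le_trans low up; rewrite mE => e.
have eK : K / (q * q) <= K / q.
  by rewrite ler_wpM2l// lef_pV2 ?posrE ?mulr_gt0// ler_peMl// ltW.
have eK1 : (1 + q) * ((1 + K) / (q * q)) <= 2 * (1 + K) / q.
  rewrite (_ : _ * (_ / _) = ((1 + q) / q) * (1 + K) / q); last first.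
    by field; rewrite gt_eqF.
  rewrite ler_wpM2r ?invr_ge0 ?(ltW q0)// ler_wpM2r ?addr_ge0//.
  by rewrite ler_pdivrMr//; lra.
have -> : (a + 2 * (1 + K) + K) / q = q^-1 * a + 2 * (1 + K) / q + K / q.
  by field; rewrite gt_eqF.
move: e eK eK1; rewrite [(1 + q^-1) * a]mulrDl mul1r.
set A := K / (q * q); set B := (1 + q) * _; set C := K / q.
by set G := q^-1 * a; set H := 2 * (1 + K) / q; clearbody A B C G H; lra.
Qed.

End optional_stopping.

(** * The stopped time integral *)

Section joint_measurability.
Context d (T : measurableType d) (R : realType).

(** Stopped sums along finer and longer grids are finite sums of products of measurable functions of
    time and of outcome, and converge to [X]. They vanish at negative times, whence the factor in
    front. *)
Lemma measurable_continuous_process (X : R -> T -> R) :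
  (forall u, measurable_fun setT (X u)) -> (forall w, continuous (X ^~ w)) ->
  (forall w, X 0 w = 0) ->
  measurable_fun setT (fun z : measurableTypeR R * T => (0 <= z.1)%R%:R * X z.1 z.2).
Proof.
move=> mX cX X0.
pose h (n : nat) : R := n.+1%:R^-1; pose J n := (n.+1 * n.+1)%N.
have h0 n : 0 < h n by rewrite /h invr_gt0 ltr0n.
have Jh n : (J n)%:R * h n = n.+1%:R.
  by rewrite /J /h natrM mulfK// pnatr_eq0.
apply: (@measurable_fun_cvg _ _ _ _
  (fun n (z : measurableTypeR R * T) => stopped_sum (X ^~ z.2) (h n) z.1 (J n))).
  move=> n; apply: measurable_sum => j; apply: measurable_funM.
    have -> : (fun z : measurableTypeR R * T => (j%:R * h n < z.1)%R%:R) =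
        \1_(fst @^-1` `]j%:R * h n, +oo[) :> (_ -> R).
      apply/funext => z; rewrite indicE; congr ((nat_of_bool _)%:R).
      by apply/idP/idP; rewrite inE /= in_itv/= andbT.
    apply: measurable_indic; rewrite -[X in measurable X]setTI.
    by apply: (@measurable_fst _ _ (measurableTypeR R) T) => //; exact: measurable_itv.
  have mX2 u : measurable_fun setT (fun z : measurableTypeR R * T => X u z.2).
    exact: measurableT_comp (mX u) (@measurable_snd _ _ (measurableTypeR R) T).
  exact: measurable_funB.
move=> [u w] _ /=; have [u0|u0] := leP 0 u; last first.
  rewrite mul0r; apply: cvg_near_cst; apply: nearW => n.
  rewrite /stopped_sum big1// => j _.
  by rewrite ltNge (le_trans (ltW u0)) ?mulr_ge0 ?mul0r// ltW.
rewrite mul1r -[X in _ --> X]subr0 -(X0 w).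
apply: (@stopped_sum_cvg _ (X ^~ w)) => //; first exact: cvg_harmonic.
near=> n; rewrite Jh; apply: (@le_trans _ _ n%:R); last by rewrite ler_nat.
by near: n; exact: nbhs_infty_ger.
Unshelve. all: by end_near. Qed.

End joint_measurability.

Lemma integral_indic_itvM (R : realType) (a c : R) : 0 <= a ->
  (\int[@lebesgue_measure R]_u (\1_`[0%R, a[ u * c)%:E = (a * c)%:E)%E.
Proof.
move=> a0; under eq_integral do rewrite EFinM.
rewrite integralZr//; last first.
  by apply: integrable_indic_itv.
rewrite integral_indic//= setIT lebesgue_measure_itv/= lte_fin EFinM; congr (_ * _)%E.
case: ltP => [_|a0']; first by rewrite oppr0 adde0.
by congr EFin; apply/eqP; rewrite eq_le a0 a0'.
Qed.

Section stopped_integral.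
Context d (T : measurableType d) (R : realType) (P : probability T R).
Variables (X : R -> T -> R) (F : R -> set_system T) (tau : T -> R).
Hypotheses (hX : adapted_motion P X F) (tau_ge0 : forall w, 0 <= tau w)
  (stau : square_integrable P tau)
  (Ftau : forall u, 0 <= u -> F u [set w | u < tau w]).

Local Notation leb := (@lebesgue_measure R).
Local Notation after u := [set w : T | u < tau w].
Local Notation XT := (fun w => X (tau w) w).
Local Notation RT := (measurableTypeR R * T)%type.

Let before : set RT := [set z | 0 <= z.1 < tau z.2].

Let sXT : square_integrable P XT.
Proof. exact: (square_integrable_stopped hX). Qed.

Let mtau : measurable_fun setT tau. Proof. by case: stau. Qed.

Let mbefore : measurable before.
Proof.
have m1 := @measurable_fst _ _ (measurableTypeR R) T.
have m2 := @measurable_snd _ _ (measurableTypeR R) T.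
have mf : measurable_fun [set: RT] (fun z => tau z.2 - z.1).
  by apply: measurable_funB => //; exact: measurableT_comp mtau m2.
rewrite (_ : before = (fst @^-1` `[0, +oo[) `&`
    ((fun z : RT => tau z.2 - z.1) @^-1` `]0, +oo[)); last first.
  apply/seteqP; split => z; rewrite /before /= !in_itv/= !andbT subr_gt0.
    by move/andP.
  by move=> [-> ->].
apply: measurableI; rewrite -[X in measurable X]setTI.
  by apply: m1 => //; exact: measurable_itv.
by apply: mf => //; exact: measurable_itv.
Qed.

Let beforeE u w : \1_before (u, w) = (0 <= u)%R%:R * \1_(after u) w :> R.
Proof.
rewrite !indicE; have [u0|u0] := leP 0 u.
  rewrite mul1r; congr ((nat_of_bool _)%:R).
  by apply/idP/idP; rewrite !inE /before /= u0.
by rewrite mul0r memNset// /before/= leNgt u0.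
Qed.

Let before_itvE u w : \1_before (u, w) = \1_`[0, tau w[ u :> R.
Proof.
by rewrite !indicE; congr ((nat_of_bool _)%:R).
Qed.

(** [f] carries the running value and [g] the terminal one. They have the same mean on each time
    section, so Fubini applied to both exchanges them. *)
Let f (z : RT) : R := \1_before z * X z.1 z.2.
Let g (z : RT) : R := \1_before z * XT z.2.

Let mf : measurable_fun setT f.
Proof.
rewrite (_ : f = fun z => \1_before z * ((0 <= z.1)%R%:R * X z.1 z.2)).
  apply: measurable_funM; first exact: measurable_indic.
  apply: measurable_continuous_process.
  - exact: (am_measurable hX).
  - exact: (am_continuous hX).
  - exact: (am_start hX).
apply/funext => -[u w]; rewrite /f /= beforeE.
by case: (0 <= u); rewrite ?mul1r// !mul0r.
Qed.

Let mg : measurable_fun setT g.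
Proof.
apply: measurable_funM; first exact: measurable_indic.
have [mXT _] := sXT.
exact: measurableT_comp mXT (@measurable_snd _ _ (measurableTypeR R) T).
Qed.

Let mXu u : measurable_fun setT (X u). Proof. exact: (am_measurable hX). Qed.

Let mafter u : 0 <= u -> measurable (after u).
Proof. by move=> u0; exact: (am_event hX (Ftau u0)). Qed.

Let event_mean u E : 0 <= u -> F u E ->
  \int[P]_w (\1_(E `&` after u) w * X u w) =
  \int[P]_w (\1_(E `&` after u) w * XT w).
Proof.
move=> u0 FE.
have mE : measurable (E `&` after u).
  by apply: measurableI; [exact: (am_event hX FE)|exact: mafter].
have i1 : P.-integrable setT (EFin \o (fun w => \1_(E `&` after u) w * XT w)).
  by apply: integrable_indicM => //; exact: square_integrable_integrable.
have i2 : P.-integrable setT (EFin \o (fun w => \1_(E `&` after u) w * X u w)).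
  apply: integrable_indicM => //; apply: square_integrable_integrable.
  exact: (square_integrable_motion hX).
apply/esym/eqP; rewrite -subr_eq0 -RintegralB//.
under eq_Rintegral do rewrite -mulrBr.
by apply/eqP; exact: (stopped_event_mean hX).
Qed.

Let section_mean u : (\int[P]_w (f (u, w))%:E = \int[P]_w (g (u, w))%:E)%E.
Proof.
rewrite /f /g /=; have [u0|u0] := ltP u 0.
  by under eq_integral do rewrite beforeE leNgt u0 /= !mul0r;
     under [RHS]eq_integral do rewrite beforeE leNgt u0 /= !mul0r.
have FT := am_setT hX u.
have mE := mafter u0.
have i1 : P.-integrable setT (EFin \o (fun w => \1_(after u) w * XT w)).
  by apply: integrable_indicM => //; exact: square_integrable_integrable.
have i2 : P.-integrable setT (EFin \o (fun w => \1_(after u) w * X u w)).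
  apply: integrable_indicM => //; apply: square_integrable_integrable.
  exact: (square_integrable_motion hX).
under eq_integral do rewrite beforeE u0 mul1r.
under [RHS]eq_integral do rewrite beforeE u0 mul1r.
rewrite -(EFin_Rintegral i1) -(EFin_Rintegral i2).
by have := event_mean u0 FT; rewrite setTI => ->.
Qed.

(* |X_u| is X_u on {X_u >= 0} and -X_u elsewhere; both events are known at time u. *)
Let section_abs u :
  (\int[P]_w `|(f (u, w))%:E| <= \int[P]_w `|(g (u, w))%:E|)%E.
Proof.
rewrite /f /g /=; have [u0|u0] := ltP u 0.
  by under eq_integral do rewrite beforeE leNgt u0 /= !mul0r;
     under [in leRHS]eq_integral do rewrite beforeE leNgt u0 /= !mul0r.
have mE := mafter u0.
pose Ep : set T := X u @^-1` `[0, +oo[.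
have FEp : F u Ep by apply: (am_adapted hX) => //; exact: measurable_itv.
have FEn : F u (~` Ep).
  by rewrite -setTD; apply: (am_setD hX) => //; exact: (am_setT hX).
have iXT E : measurable E -> P.-integrable setT (EFin \o (fun w => \1_E w * XT w)).
  by move=> ?; apply: integrable_indicM => //; exact: square_integrable_integrable.
have iXu E : measurable E -> P.-integrable setT (EFin \o (fun w => \1_E w * X u w)).
  move=> ?; apply: integrable_indicM => //; apply: square_integrable_integrable.
  exact: (square_integrable_motion hX).
have mp : measurable (Ep `&` after u).
  by apply: measurableI => //; exact: (am_event hX FEp).
have mn : measurable ((~` Ep) `&` after u).
  by apply: measurableI => //; exact: (am_event hX FEn).
have absE w : `|\1_(after u) w * X u w| =
    \1_(Ep `&` after u) w * X u w - \1_((~` Ep) `&` after u) w * X u w.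
  rewrite !indicI indicC indicE /= [\1_Ep w]indicE.
  have [Xu|Xu] := leP 0 (X u w).
    rewrite (_ : (w \in Ep) = true); last by rewrite mem_set// /Ep/= in_itv/= Xu.
    by rewrite ger0_norm ?mulr_ge0// mul1r !mul0r subr0.
  rewrite (_ : (w \in Ep) = false); last first.
    by apply: memNset; rewrite /Ep/= in_itv/= andbT leNgt Xu.
  by rewrite ler0_norm ?mulr_ge0_le0 ?(ltW Xu)// indicE !mul0r sub0r mul1r.
have absT w : \1_(Ep `&` after u) w * XT w - \1_((~` Ep) `&` after u) w * XT w
    <= `|\1_(after u) w * XT w|.
  rewrite !indicI indicC /= !indicE normrM normr_nat.
  case: (w \in Ep); case: (w \in after u);
    rewrite /= ?mul0r ?mulr0 ?mul1r ?mul0r ?subr0 ?sub0r ?oppr0 ?ler_norm//.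
  by rewrite -normrN ler_norm.
under eq_integral do rewrite beforeE u0 mul1r absE.
under [in leRHS]eq_integral do rewrite beforeE u0 mul1r.
rewrite -EFin_Rintegral; last by apply: integrable_EFinB; exact: iXu.
have iabs := integrable_abse (iXT _ mE).
rewrite -(EFin_Rintegral (f := fun w => `|\1_(after u) w * XT w|)) ?lee_fin; last first.
  exact: iabs.
rewrite RintegralB; [|by []|exact: iXu..].
rewrite (event_mean u0 FEp) (event_mean u0 FEn) -RintegralB; [|by []|exact: iXT..].
apply: le_Rintegral => //.
by apply: integrable_EFinB; exact: iXT.
Qed.

(** Integrating over time first leaves [tau] times the absolute stopped value, a product of two
    square integrable variables. *)
Let integrable_g : (leb \x P)%E.-integrable setT (EFin \o g).
Proof.
apply/integrable21ltyP; first exact/measurable_EFinP.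
rewrite (@eq_integral _ _ _ P setT (fun w => (tau w * `|XT w|)%:E)).
  have [mXT _] := sXT.
  have sA : square_integrable P (fun w => `|XT w|).
    apply: (square_integrable_le _ sXT); last by move=> w; rewrite normr_id.
    exact: measurableT_comp.
  have i := square_integrable_mul stau sA.
  by rewrite -(EFin_Rintegral i) ltry.
move=> w _; rewrite -integral_indic_itvM//; apply: eq_integral => u _.
by rewrite /= /g /= before_itvE normrM ger0_norm.
Qed.

(** No pointwise domination by [g] is available; [section_abs] compares the means at each fixed
    time, and Tonelli with time outside asks for no more. *)
Let integrable_f : (leb \x P)%E.-integrable setT (EFin \o f).
Proof.
apply/integrable12ltyP; first exact/measurable_EFinP.
have mfe : measurable_fun setT (EFin \o f) by exact/measurable_EFinP.
have mge : measurable_fun setT (EFin \o g) by exact/measurable_EFinP.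
have := (integrable12ltyP leb P mge).1 integrable_g.
apply: le_lt_trans; apply: ge0_le_integral => //=.
- by move=> u _; exact: integral_ge0.
- apply: (measurable_fun_fubini_tonelli_F (abse \o (EFin \o f))).
    exact: measurableT_comp mfe.
  by move=> z; exact: abse_ge0.
- apply: (measurable_fun_fubini_tonelli_F (abse \o (EFin \o g))).
    exact: measurableT_comp mge.
  by move=> z; exact: abse_ge0.
- by move=> u _; exact: section_abs.
Qed.

Let sectionf w : (\int[leb]_u (f (u, w))%:E)%E =
  (\int[leb]_(u in `[0, tau w]) X u w)%:E.
Proof.
rewrite /Rintegral fineK; last first.
  apply: integrable_fin_num => //; apply: continuous_compact_integrable.
    exact: segment_compact.
  by apply: continuous_subspaceT; exact: (am_continuous hX).
rewrite -integral_itv_bndo_bndc; last first.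
  apply/measurable_funTS/measurable_EFinP.
  exact: continuous_measurable_fun (am_continuous hX (w := w)).
rewrite [RHS]integral_mkcond; apply: eq_integral => u _.
by rewrite /f before_itvE patchE indicE; case: ifP => _; rewrite ?mul1r ?mul0r.
Qed.

Lemma integrable_stopped_integral : P.-integrable setT
  (EFin \o (fun w => \int[leb]_(u in `[0, tau w]) X u w)).
Proof.
have mfe : measurable_fun setT (EFin \o f) by exact/measurable_EFinP.
rewrite (_ : EFin \o _ = fubini_G leb (EFin \o f)); last first.
  by apply/funext => w /=; rewrite -sectionf.
have mG := measurable_fubini_G integrable_f.
apply/integrableP; split => //.
apply: le_lt_trans ((integrable21ltyP leb P mfe).1 integrable_f).
apply: ge0_le_integral => //=.
- exact: measurableT_comp.
- apply: (measurable_fun_fubini_tonelli_G (abse \o (EFin \o f))).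
    exact: measurableT_comp mfe.
  by move=> z; exact: abse_ge0.
- move=> w _; apply: le_abse_integral => //.
  exact: measurableT_comp mfe (measurable_pair2 w).
Qed.

Lemma stopped_integral_mean :
  \int[P]_w (\int[leb]_(u in `[0, tau w]) X u w) = \int[P]_w (tau w * XT w).
Proof.
rewrite [LHS]/Rintegral [RHS]/Rintegral; congr fine.
transitivity (\int[P]_w \int[leb]_u (EFin \o f) (u, w))%E.
  by apply: eq_integral => w _; rewrite -sectionf.
rewrite -(Fubini integrable_f).
transitivity (\int[leb]_u \int[P]_w (EFin \o g) (u, w))%E.
  by apply: eq_integral => u _; exact: section_mean.
rewrite (Fubini integrable_g); apply: eq_integral => w _.
rewrite -integral_indic_itvM//; apply: eq_integral => u _.
Qed.

End stopped_integral.

(** * Passing to the continuous version *)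

Section full_measure.
Context d (T : measurableType d) (R : realType) (mu : {measure set T -> \bar R}).
Variables (A : set T) (mA : measurable A) (muA : mu (~` A) = 0%E).
Import HBNNSimple.

(** Cutting a simple function below [f] down to [A] keeps its integral and puts it below the
    restriction of [f], so the two suprema coincide. *)
Let ge0_integral_full (f : T -> \bar R) : (forall w, 0 <= f w)%E ->
  (\int[mu]_w f w = \int[mu]_(w in A) f w)%E.
Proof.
move=> f0; rewrite [RHS]integral_mkcond.
have fA0 w : (0 <= (f \_ A) w)%E by exact: erestrict_ge0.
rewrite !ge0_integralTE//; apply/eqP; rewrite eq_le; apply/andP; split.
  apply: ge_ereal_sup => _ [h hf <-]; apply: ereal_sup_ubound.
  exists (proj_nnsfun h mA) => [w|].
    rewrite /= mindicE patchE; case: ifPn => wA; last by rewrite mulr0.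
    by rewrite mulr1.
  rewrite -!integralT_nnsfun.
  apply: ae_eq_integral => //; [exact/measurable_EFinP..|].
  exists (~` A); split => //; first exact: measurableC.
  move=> w /= h'; apply: contra_not h' => Aw _.
  by rewrite mindicE mem_set// mulr1.
apply: ge_ereal_sup => _ [h hf <-]; apply: ereal_sup_ubound.
exists h => // w; apply: le_trans (hf w) _.
by rewrite patchE; case: ifP.
Qed.

(* No measurability is assumed: the integral of an arbitrary function is the
   difference of two suprema over simple functions, which ignore null sets. *)
Lemma integral_eq_full (f g : T -> \bar R) : (forall w, A w -> f w = g w) ->
  (\int[mu]_w f w = \int[mu]_w g w)%E.
Proof.
move=> fg; rewrite [LHS]integralE [RHS]integralE.
congr (_ - _)%E; rewrite ge0_integral_full// [RHS]ge0_integral_full//;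
  apply: eq_integral => w; rewrite inE => Aw.
  by rewrite funeposE funeposE fg.
by rewrite funenegE funenegE fg.
Qed.

End full_measure.

Lemma measurable_stopping_time d (T : measurableType d) (R : realType)
    (G : R -> set_system T) (tau : T -> \bar R) :
  (forall t, G t `<=` measurable) -> stopping_time G tau ->
  measurable_fun setT tau.
Proof.
move=> mG [tau0 Gtau].
apply: (measurability _ (ErealGenOInfty.measurableE R)) => // _ [_ [r ->] <-].
rewrite setTI; have [r0|r0] := leP 0 r.
  rewrite (_ : _ @^-1` _ = ~` [set w | (tau w <= r%:E)%E]).
    by apply: measurableC; apply: mG; exact: Gtau.
  apply/seteqP; split => w /=; rewrite in_itv/= andbT ltNge.
    by move/negP.
  by move/negP.
rewrite (_ : _ @^-1` _ = setT)//; apply/seteqP; split => w //= _.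
by rewrite in_itv/= andbT; apply: lt_le_trans (tau0 w); rewrite lte_fin.
Qed.

Lemma Rintegral_id (R : realType) (a : R) : 0 <= a ->
  \int[@lebesgue_measure R]_(u in `[0, a]) u = a ^+ 2 / 2.
Proof.
rewrite le_eqVlt => /predU1P[<-|a0].
  by rewrite set_itv1 Rintegral_set1 expr0n/= mul0r.
rewrite /Rintegral.
have := @continuous_FTC2 R id (fun x => x ^+ 2 / 2) 0 a a0.
have dF (x : R) : is_derive x 1 (fun x : R => x ^+ 2 / 2) x.
  apply: is_derive_eq.
  by rewrite /GRing.scale /=; field.
have cF : continuous (fun x : R => x ^+ 2 / 2).
  by move=> x; apply: cvgM; [exact: exprn_continuous|exact: cvg_cst].
move=> ->.
- by rewrite -EFinB /= expr0n/= mul0r subr0.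
- by apply: continuous_subspaceT => x; exact: cvg_id.
- split.
  + by move=> x _; have [] := dF x.
  + exact/cvg_at_right_filter/cF.
  + exact/cvg_at_left_filter/cF.
- by move=> x _; rewrite derive1E; have [_ ->] := dF x.
Qed.

Section completion.
Context d (T : measurableType d) (R : realType) (P : probability T R) (n : nat).
Variables (B : 'I_n -> R -> {RV P >-> R}) (D sigma : 'I_n -> R) (i : 'I_n).
Hypotheses (hB : forall j, standard_brownian_motion (B j))
  (hindep : independent_processes B) (hsigma : forall j, 0 < sigma j).
Variables (A : set T) (mA : measurable A) (PA : P (~` A) = 0%E).
Hypotheses (A0 : forall w, A w -> B i 0 w = 0)
  (Ac : forall w, A w -> {within `[0, +oo[, continuous (fun t : R => B i t w)}).

Local Notation G := (natural_filtration (drifted_process D sigma B)).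

(** The indicator replaces exceptional paths by 0, and the absolute value extends the others evenly
    to negative times, so that continuity on the half-line becomes continuity everywhere. *)
Definition continuous_version (u : R) (w : T) : R := \1_A w * B i `|u| w.

Definition completed_filtration (u : R) (E : set T) : Prop :=
  measurable E /\ exists2 E', G u E' & forall w, A w -> E w <-> E' w.

Lemma measurable_drifted j u : measurable_fun setT (drifted_process D sigma B j u).
Proof. by apply: measurable_funD => //; exact: measurable_funM. Qed.

Lemma natural_filtration_measurable u : G u `<=` measurable.
Proof.
apply: sigma_generated_measurable => -[j v]; exact: measurable_drifted.
Qed.

Lemma continuous_version_eq u w : A w -> 0 <= u -> continuous_version u w = B i u w.
Proof.
by move=> Aw u0; rewrite /continuous_version indicE mem_set// mul1r ger0_norm.
Qed.

Lemma continuous_version_adapted :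
  adapted_motion P continuous_version completed_filtration.
Proof.
have GT u : G u setT by exact: sigma_generatedT.
split.
- by move=> u; apply: measurable_funM => //; exact: measurable_indic.
- move=> w; rewrite /continuous_version normr0.
  have [Aw|nAw] := pselect (A w); first by rewrite A0// mulr0.
  by rewrite indicE memNset// mul0r.
- move=> w; have [Aw|nAw] := pselect (A w); last first.
    rewrite (_ : (fun u => _) = cst 0); first by move=> u; exact: cvg_cst.
    by apply/funext => u; rewrite /continuous_version indicE memNset// mul0r.
  move=> u; apply: cvgM; first exact: cvg_cst.
  have /subspace_continuousP/(_ `|u|) := Ac Aw.
  rewrite /= in_itv/= andbT normr_ge0 => /(_ isT) h.
  apply: (cvg_comp (fun t : R => `|t|) (fun t => B i t w) _ h).
  move=> S /=; rewrite /within/= => hS.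
  have hv : \forall v \near u, `|v| \in `[0, +oo[ -> S `|v|.
    exact: (@norm_continuous _ R u _ hS).
  by apply: filterS hv => v; apply; rewrite in_itv/= andbT.
- by move=> u E [].
- by move=> u; split => //; exists setT.
- move=> u E E' [mE [H GH EH]] [mE' [H' GH' EH']]; split; first exact: measurableI.
  exists (H `&` H'); first exact: sigma_generatedI.
  by move=> w Aw; split => -[? ?]; split; apply/EH || apply/EH'.
- move=> u E E' [mE [H GH EH]] [mE' [H' GH' EH']]; split; first exact: measurableD.
  exists (H `\` H').
    rewrite setDE; apply: sigma_generatedI => //.
    exact: sigma_algebraC.
  move=> w Aw; split => -[? ne]; split; try (by apply/EH);
    by move=> ?; apply: ne; apply/EH'.
- move=> u v uv E [mE [H GH EH]]; split => //; exists H => //.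
  move: GH; apply: sigma_generated_sub => -[j t] /= /andP[t0 tu].
  by rewrite t0 (le_trans tu).
- move=> u C u0 mC; split.
    rewrite -[X in measurable X]setTI.
    have : measurable_fun setT (continuous_version u).
      by apply: measurable_funM => //; exact: measurable_indic.
    exact.
  exists (B i u @^-1` C); last first.
    by move=> w Aw /=; rewrite continuous_version_eq.
  (* Inverting the affine map, possible because [sigma i] is positive, expresses an event about
     [B i u] through the drifted process that generates [G u]. *)
  rewrite (_ : _ @^-1` _ = drifted_process D sigma B i u @^-1`
      ((fun x => (x - D i * u) / sigma i) @^-1` C)); last first.
    apply/seteqP; split => w /=;
      by rewrite /drifted_process addrC addKr mulrC mulKf// gt_eqF.
  apply: (sigma_generated_preimage (i := (i, u))) => /=; first by rewrite u0 lexx.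
  rewrite -[X in measurable X]setTI.
  have : measurable_fun setT (fun x : R => (x - D i * u) / sigma i).
    by apply: measurable_funM => //; exact: measurable_funB.
  exact.
- move=> s t E C s0 st [mE [H GH EH]] mC.
  have mH := natural_filtration_measurable GH.
  have mincr : measurable (increment (B i) s t @^-1` C).
    by rewrite -[X in measurable X]setTI; exact: measurable_increment.
  have PE : P E = P H by exact: (eq_measure_full mA PA).
  rewrite PE -[normal_prob _ _ _](bm_gaussian_increments (hB i) s0 st mC).
  rewrite -[RHS](filtration_indep i hB hindep s0 (ltW st) mC GH).
  apply: (eq_measure_full mA PA).
  + apply: measurableI => //; rewrite -[X in measurable X]setTI.
    have mX u : measurable_fun setT (continuous_version u).
      by apply: measurable_funM => //; exact: measurable_indic.
    have : measurable_fun setT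
      (fun w => continuous_version t w - continuous_version s w).
      exact: measurable_funB.
    exact.
  + exact: measurableI.
  + move=> w Aw; rewrite /= /increment.
    rewrite !continuous_version_eq// ?(ltW (le_lt_trans s0 st))//.
    by split => -[/(EH _ Aw) ? ?].
Qed.
End completion.

Lemma expectation_eq_full d (T : measurableType d) (R : realType)
    (P : probability T R) (A : set T) (f g : T -> R) :
  measurable A -> P (~` A) = 0%E -> P.-integrable setT (EFin \o g) ->
  (forall w, A w -> f w = g w) -> ('E_P[f] = (\int[P]_w g w)%:E)%E.
Proof.
move=> mA PA ig fg; rewrite unlock EFin_Rintegral//.
by apply: (integral_eq_full mA PA) => w Aw; rewrite fg.
Qed.

(** * Expectations at the clearing time *)

Theorem proposition2 (R : realType) (d : measure_display)
    (Omega : measurableType d) (P : probability Omega R)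
    (n : nat) (hn : (1 <= n)%N)
    (B : 'I_n -> R -> {RV P >-> R})
    (hB : forall i, standard_brownian_motion (B i))
    (hindep : independent_processes B)
    (D sigma : 'I_n -> R)
    (hD : forall i, 0 < D i) (hsigma : forall i, 0 < sigma i)
    (tau : Omega -> \bar R)
    (htau : stopping_time (natural_filtration (drifted_process D sigma B)) tau)
    (htau2 : (\int[P]_w (tau w ^+ 2) < +oo)%E) :
  forall i : 'I_n,
    let N := drifted_process D sigma B i in
    let EintN := 'E_P[integral_up_to N tau]%E in
    let ENtau := 'E_P[stopped N tau]%E in
    let ENtau2 := 'E_P[(fun w => stopped N tau w ^+ 2)%R]%E in
    let EtauB := 'E_P[(fun w => fine (tau w) * stopped (B i) tau w)%R]%E in
    (* the expectations exist and are finite (-oo + +oo = -oo, so a finite value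
       forces both the positive and negative parts to be finite) *)
    [/\ EintN \is a fin_num, ENtau \is a fin_num,
        ENtau2 \is a fin_num & EtauB \is a fin_num] /\
    EintN = ((1 / (2 * D i))%:E * ENtau2
             - (sigma i ^+ 2 / (2 * D i ^+ 2))%:E * ENtau)%E /\
    EintN = ((D i / 2)%:E * (\int[P]_w (tau w ^+ 2))
             + (sigma i)%:E * EtauB)%E.
Proof.
move=> i N EintN ENtau ENtau2 EtauB.
have [tau_ge0 Gtau] := htau.
have mtau : measurable_fun setT tau.
  by apply: measurable_stopping_time htau => t; exact: natural_filtration_measurable.
have mtau2 : measurable_fun setT (fun w => (tau w ^+ 2)%E) by exact: emeasurable_funM.
have itau2 : P.-integrable setT (fun w => (tau w ^+ 2)%E).
  apply/integrableP; split => //.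
  by under eq_integral do rewrite gee0_abs ?expe_ge0//.
(* [M] is one null set containing the paths with a bad start, those with a discontinuity, and the
   outcomes where [tau] is infinite; the last are negligible because [tau] squared is integrable. *)
have [M [mM PM hM]] : {ae P, forall w, [/\ B i 0 w = 0,
    {within `[0, +oo[, continuous (fun t : R => B i t w)} & tau w \is a fin_num]}.
  have tau_fin : {ae P, forall w, tau w \is a fin_num}.
    apply: filterS (integrable_ae measurableT itau2) => w /(_ Logic.I).
    by have := tau_ge0 w; case: (tau w) => [r| |]//=.
  by apply: filterS3 (bm_start (hB i)) (bm_continuous_paths (hB i)) tau_fin.
pose A := ~` M.
have mA : measurable A by exact: measurableC.
have PA : P (~` A) = 0%E by rewrite setCK.
have hA w : A w -> [/\ B i 0 w = 0,
    {within `[0, +oo[, continuous (fun t : R => B i t w)} & tau w \is a fin_num].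
  by move=> Aw; apply: contrapT => nh; apply: Aw; exact: hM.
have A0 w : A w -> B i 0 w = 0 by case/hA.
have Ac w : A w -> {within `[0, +oo[, continuous (fun t : R => B i t w)} by case/hA.
have hX := continuous_version_adapted D hB hindep hsigma mA PA A0 Ac.
set X := continuous_version B i A in hX.
set F := completed_filtration _ _ _ _ in hX.
pose T0 w : R := \1_A w * fine (tau w).
have T0E w : A w -> T0 w = fine (tau w) by move=> Aw; rewrite /T0 indicE mem_set// mul1r.
have T0_ge0 w : 0 <= T0 w by rewrite /T0 mulr_ge0// fine_ge0.
have mT0 : measurable_fun setT T0.
  apply: measurable_funM; first exact: measurable_indic.
  exact: measurableT_comp.
have T02 : (\int[P]_w (T0 w ^+ 2)%:E = \int[P]_w (tau w ^+ 2))%E.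
  apply: (integral_eq_full mA PA) => w Aw.
  have [_ _ /fineK tauE] := hA _ Aw.
  by rewrite T0E// expr2 EFinM tauE.
have sT0 : square_integrable P T0.
  split => //; apply/integrableP; split.
    by apply/measurable_EFinP; exact: measurable_funX.
  by under eq_integral do rewrite /= ger0_norm ?sqr_ge0//; rewrite T02.
have FT0 u : 0 <= u -> F u [set w | u < T0 w].
  move=> u0; split.
    rewrite (_ : [set w | _] = T0 @^-1` `]u, +oo[).
      by rewrite -[X in measurable X]setTI; apply: mT0.
    by apply/seteqP; split => w /=; rewrite in_itv/= andbT.
  exists (~` [set w | (tau w <= u%:E)%E]).
    by apply: sigma_algebraC; exact: Gtau.
  move=> w Aw; have [_ _ /fineK tauE] := hA _ Aw.
  by rewrite /= T0E// -tauE lee_fin ltNge; split => /negP.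
pose XT w := X (T0 w) w.
have sXT : square_integrable P XT by exact: (square_integrable_stopped hX).
have XT1 : \int[P]_w XT w = 0 by exact: (stopped_mean hX).
have XT2 : \int[P]_w (XT w ^+ 2) = \int[P]_w T0 w by exact: (stopped_sqr_mean hX).
pose S w := \int[lebesgue_measure]_(u in `[0, T0 w]) X u w.
have iS : P.-integrable setT (EFin \o S) by exact: (integrable_stopped_integral hX).
have ES : \int[P]_w S w = \int[P]_w (T0 w * XT w) by exact: (stopped_integral_mean hX).
have [_ iT02] := sT0; have [_ iXT2] := sXT.
have iT0 := square_integrable_integrable sT0.
have iXT := square_integrable_integrable sXT.
have iTX := square_integrable_mul sT0 sXT.
have XTE w : A w -> B i (fine (tau w)) w = XT w.
  by move=> Aw; rewrite /XT T0E// /X continuous_version_eq ?fine_ge0.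
have hint w : A w -> integral_up_to N tau w = D i / 2 * T0 w ^+ 2 + sigma i * S w.
  move=> Aw; rewrite /integral_up_to -(T0E w Aw).
  have cX : continuous (X ^~ w) by exact: (am_continuous hX).
  have seg (f : R -> R) : continuous f ->
      lebesgue_measure.-integrable `[0, T0 w] (EFin \o f).
    move=> cf; apply: continuous_compact_integrable; first exact: segment_compact.
    exact: continuous_subspaceT.
  transitivity (\int[lebesgue_measure]_(u in `[0, T0 w]) (D i * u + sigma i * X u w)).
    apply: eq_Rintegral => u; rewrite inE /= in_itv/= => /andP[u0 _].
    by rewrite /N /drifted_process /X continuous_version_eq.
  have cid : continuous (@id R) by move=> u; exact: cvg_id.
  have cM (c : R) (f : R -> R) : continuous f -> continuous (fun u => c * f u).
    by move=> cf u; apply: cvgM; [exact: cvg_cst|exact: cf].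
  rewrite RintegralD//;
    [|exact: (seg _ (cM (D i) id cid))|exact: (seg _ (cM (sigma i) _ cX))].
  rewrite RintegralZl//; last exact: (seg _ cid).
  rewrite RintegralZl//; last exact: (seg _ cX).
  by rewrite Rintegral_id// /S; field.
have E1 : EintN = (D i / 2 * \int[P]_w (T0 w ^+ 2) +
    sigma i * \int[P]_w (T0 w * XT w))%:E.
  rewrite /EintN (expectation_eq_full mA PA _ hint); last first.
    by apply: integrable_EFinD; exact: integrable_EFinZ.
  by rewrite RintegralD//; [rewrite !RintegralZl// ES|exact: integrable_EFinZ..].
have E2 : ENtau = (D i * \int[P]_w T0 w)%:E.
  rewrite /ENtau (expectation_eq_full (g := fun w => D i * T0 w + sigma i * XT w) mA PA).
  - rewrite RintegralD//; [|exact: integrable_EFinZ..].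
    by rewrite !RintegralZl// XT1 mulr0 addr0.
  - by apply: integrable_EFinD; exact: integrable_EFinZ.
  - by move=> w Aw; rewrite /stopped /N /drifted_process XTE// T0E.
have E3 : ENtau2 = (D i ^+ 2 * \int[P]_w (T0 w ^+ 2) +
    2 * D i * sigma i * \int[P]_w (T0 w * XT w) + sigma i ^+ 2 * \int[P]_w T0 w)%:E.
  rewrite /ENtau2 (expectation_eq_full (g := fun w => D i ^+ 2 * T0 w ^+ 2 +
    2 * D i * sigma i * (T0 w * XT w) + sigma i ^+ 2 * XT w ^+ 2) mA PA).
  - rewrite RintegralD//;
      [|by apply: integrable_EFinD; exact: integrable_EFinZ|exact: integrable_EFinZ].
    rewrite RintegralD//; [|exact: integrable_EFinZ..].
    by rewrite !RintegralZl// XT2.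
  - by apply: integrable_EFinD; [apply: integrable_EFinD|]; exact: integrable_EFinZ.
  - by move=> w Aw; rewrite /stopped /N /drifted_process XTE// T0E//; ring.
have E4 : EtauB = (\int[P]_w (T0 w * XT w))%:E.
  apply: (expectation_eq_full mA PA iTX) => w Aw.
  by rewrite /stopped XTE// T0E.
rewrite E1 E2 E3 E4 -T02 -(EFin_Rintegral iT02); split => //.
rewrite -!EFinM -EFinB -EFinD; split; congr EFin.
(* The term [sigma i ^+ 2] times the mean of [T0] in [E3], which comes from [XT2], cancels against
   [E2]; what is left is [E1]. *)
by have := hD i; move=> Di; field; rewrite gt_eqF.
Qed.
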